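(* Let $(X,\mu)$ be a measure space with $\mu(X)<\infty$, and let $\mathcal{H}$ be a Hilbert space. For a countable family $\mathscr{A}\subseteq L^2(X;\mathcal{H})$ and constants $0<A\le B<\infty$, the following are equivalent: (i) For some orthonormal basis $\mathcal{D}$ of $L^2(X)$, $\{g\varphi : g\in\mathcal{D},\ \varphi\in\mathscr{A}\}$ is a Riesz sequence in $L^2(X;\mathcal{H})$ with bounds $A,B$. (ii) For any Riesz sequence $(g_i)_{i\in I}$ in $L^2(X)$ with bounds $a,b$, $\{g_i\varphi : i\in I,\ \varphi\in\mathscr{A}\}$ is a Riesz sequence in $L^2(X;\mathcal{H})$ with bounds $aA,\,bB$. (iii) For any family $(f_\varphi)_{\varphi\in\mathscr{A}}\subseteq L^2(X)$ having only finitely many $f_\varphi\neq 0$, $$A\sum_{\varphi\in\mathscr{A}}\int_X|f_\varphi(x)|^2\,d\mu(x)\ \le\ \int_X\Big\|\sum_{\varphi\in\mathscr{A}}f_\varphi(x)\varphi(x)\Big\|^2 d\mu(x)\ \le\ B\sum_{\varphi\in\mathscr{A}}\int_X|f_\varphi(x)|^2\,d\mu(x).\qquad(\ast)$$ (iv) For any family $(f_\varphi)_{\varphi\in\mathscr{A}}\subseteq L^2(X)$ with $\sum_{\varphi\in\mathscr{A}}\|f_\varphi\|_{L^2(X)}^2<\infty$, the inequalities $(\ast)$ hold. (v) For almost every $x\in X$, $\{\varphi(x):\varphi\in\mathscr{A}\}$ is a Riesz sequence in $\mathcal{H}$ with bounds $A,B$.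
   Context: For $g\colon X\to\mathbb{C}$ and $\varphi\colon X\to\mathcal{H}$, the product is the pointwise one, $(g\varphi)(x)=g(x)\varphi(x)$. A countable family $(u_i)_{i\in I}$ of vectors in a Hilbert space $\mathcal{K}$ is called a Riesz sequence if there are constants $0<A\le B<\infty$ (called bounds) such that for all $(c_i)_{i\in I}\in l^2(I)$ with only finitely many $c_i\ne0$, $$A\sum_{i\in I}|c_i|^2\le\Big\|\sum_{i\in I}c_iu_i\Big\|^2\le B\sum_{i\in I}|c_i|^2 .$$ Sets such as $\{g\varphi : g\in\mathcal{D},\varphi\in\mathscr{A}\}$ are considered with multiplicities, that is, as indexed families. *)

(* Defs.v *)
From HB Require Import structures.
From mathcomp Require Import all_boot all_order all_algebra sesquilinear complex.
From mathcomp Require Import all_classical all_reals all_analysis.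
From mathcomp.analysis.showcase Require Import summability.
Import Order.TTheory GRing.Theory Num.Theory Num.Def.
Import numFieldNormedType.Exports.

Set Implicit Arguments.
Unset Strict Implicit.
Unset Printing Implicit Defensive.

Local Open Scope classical_set_scope.
Local Open Scope ring_scope.

(* Norms over the scalar field R[i] are R[i]-valued; they are real, so taking
   the real part loses nothing. *)
Definition sqnorm (R : realType) (V : normedModType R[i]) (v : V) : R :=
  complex.Re `|v| ^+ 2.

(* [K] is the ambient Hilbert space, as a set of vectors of [V], and [N] its
   squared norm. With [K := L2 mu V] and [N := sqnormL2 mu], the vectors of the
   Hilbert space are represented by functions, and [N] only depends on their
   class modulo equality almost everywhere.
   Countability of the index type is not built in: it is required explicitly
   where a family is assumed to be countable. It cannot be required of
   families indexed by an orthonormal basis of [L2 mu R[i]^o], since this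
   space need not be separable. *)
Definition riesz_sequence (R : realType) (V : lmodType R[i]) (K : set V)
    (N : V -> \bar R) (I : choiceType) (u : I -> V) (A B : R) : Prop :=
  [/\ 0 < A <= B,
      forall i, K (u i)
    & forall c : I -> R[i], finite_set [set i | c i != 0] ->
      let s := \sum_(i \in [set: I]) sqnorm (c i : R[i]^o) in
      let v := \sum_(i \in [set: I]) c i *: u i in
      ((A * s)%:E <= N v)%E /\ (N v <= (B * s)%:E)%E].

Definition riesz_sequence_in (R : realType) (V : normedModType R[i])
    (I : choiceType) (u : I -> V) (A B : R) : Prop :=
  riesz_sequence [set: V] (fun v => (sqnorm v)%:E) u A B.

Section L2.
Context d (X : measurableType d) (R : realType).
Variable mu : {measure set X -> \bar R}.

Definition simple_function (V : Type) (s : X -> V) : Prop :=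
  finite_set (range s) /\ forall v, measurable (s @^-1` [set v]).

Definition strongly_measurable (V : normedModType R[i]) (f : X -> V) : Prop :=
  exists s : nat -> X -> V,
    (forall n, simple_function (s n)) /\ forall x, s ^~ x @ \oo --> f x.

Definition sqnormL2 (V : normedModType R[i]) (f : X -> V) : \bar R :=
  (\int[mu]_x (sqnorm (f x))%:E)%E.

(* The Bochner space L^2(X; V), through representatives: every class modulo
   equality almost everywhere contains a pointwise limit of simple functions.
   L^2(X) is the case V = R[i]^o. *)
Definition L2 (V : normedModType R[i]) : set (X -> V) :=
  [set f | strongly_measurable f /\ (sqnormL2 f < +oo)%E].

Definition innerL2 (f g : X -> R[i]^o) : R[i] :=
  Complex (\int[mu]_x complex.Re (f x * conjC (g x)))
          (\int[mu]_x complex.Im (f x * conjC (g x))).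

Definition orthonormal_basis (D : choiceType) (g : D -> X -> R[i]^o) : Prop :=
  [/\ forall i, L2 (g i),
      forall i j, innerL2 (g i) (g j) = (i == j)%:R
    & forall f : X -> R[i]^o, L2 f -> forall e : R, 0 < e ->
      exists2 c : D -> R[i], finite_set [set i | c i != 0] &
        (sqnormL2 (f - \sum_(i \in [set: D]) c i *: g i)%R < e%:E)%E].

Definition riesz_sequence_L2 (V : normedModType R[i]) (I : choiceType)
    (u : I -> X -> V) (A B : R) : Prop :=
  riesz_sequence (@L2 V) (@sqnormL2 V) u A B.

Definition products (V : normedModType R[i]) (I J : Type)
    (g : I -> X -> R[i]^o) (phi : J -> X -> V) (p : I * J) : X -> V :=
  fun x => g p.1 x *: phi p.2 x.

(* The inequalities ( * ). For infinitely many nonzero [f j], the series is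
   understood as converging unconditionally in [V], for almost every [x]:
   [summability.sum] is the limit of the finite partial sums along the
   directed set of all finite subsets of [J]. *)
Definition star (V : normedModType R[i]) (J : choiceType)
    (phi : J -> X -> V) (A B : R) (f : J -> X -> R[i]^o) : Prop :=
  let t x j := f j x *: phi j x in
  let S := (\esum_(j in [set: J]) sqnormL2 (f j))%E in
  let T := (\int[mu]_x (sqnorm (summability.sum (t x)))%:E)%E in
  [/\ {ae mu, forall x, cvg (partial_sum (t x) @ totally)},
      (A%:E * S <= T)%E
    & (T <= B%:E * S)%E].

End L2.

(* Main.v *)
Require Import Defs.
From HB Require Import structures.
From mathcomp Require Import all_boot all_order all_algebra sesquilinear complex.
From mathcomp Require Import all_classical all_reals all_analysis.
From mathcomp.analysis.showcase Require Import summability.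
From mathcomp Require Import measurable_realfun ring lra.
From mathcomp Require finmap.
Import Order.TTheory GRing.Theory Num.Theory Num.Def.
Import numFieldNormedType.Exports.
Set Implicit Arguments.
Unset Strict Implicit.
Unset Printing Implicit Defensive.
Local Open Scope classical_set_scope.
Local Open Scope ring_scope.

(** Everything passes through the pointwise condition (v).

    (v) implies the others by integration.  If the vectors phi_j(x) form a
    Riesz sequence with bounds A, B for almost every x, then the inequality
    A sum_j |f_j(x)|^2 <= |sum_j f_j(x) phi_j(x)|^2 <= B sum_j |f_j(x)|^2 holds
    at almost every x, first for finite sums and then, by completeness of H,
    for square-summable coefficients, where the series converges
    unconditionally ([cvg_riesz_sum], [riesz_sum_bounds]).  Integrating it
    gives (iv) ([star_of_ae_riesz]).  For (ii), a finite combination of the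
    products g_i phi_j is sum_j f_j phi_j with f_j a finite combination of the
    g_i, so that integration leaves sum_j |f_j|^2 in L^2(X), to which the Riesz
    bounds of g apply ([riesz_products_of_ae_riesz]).  (i) is the case of an
    orthonormal basis g, a Riesz sequence with bounds 1, 1.  L^2(X) need not be
    separable, so a basis comes from Zorn's lemma: a maximal orthonormal set
    is total because L^2(X) is complete ([maximal_orthonormal_total],
    [real_L2_complete], [orthonormal_basis_exists]).

    Conversely each of (i), (ii), (iii) yields (v).  Fix a finitely supported c
    and put w(x) = |sum_j c_j phi_j(x)|^2 and s = sum_j |c_j|^2.  It suffices
    to show A s mu(E) <= int_E w <= B s mu(E) for every measurable E: then
    A s <= w <= B s almost everywhere ([ae_le_of_setintegral_le]), and doing
    this for the countably many c with Gaussian rational entries gives, by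
    density, the Riesz inequalities for all c outside one null set
    ([ae_riesz_sequence_in]).  Under (iii) one takes f_j = c_j 1_E; under (ii)
    one takes the one-element Riesz sequence 1_E, whose bounds are both mu(E).
    Under (i) the inequality A s |h|^2 <= int |h|^2 w <= B s |h|^2 is known for
    the finite combinations h of the basis, by [sqnormL2_orthonormal], and h is
    made to approach 1_E in L^2(X).  Since w is not known to be bounded, it is
    first truncated ([ae_le_of_dense_weights]). *)

(** * Squared norms and convergence over the complex numbers *)

(** The norm of a normed space over R[i] takes values in R[i]; [rnorm] is the
    same norm in R, where limits, squares and integrals live. *)
Definition rnorm (R : realType) (V : normedModType R[i]) (v : V) : R :=
  complex.Re `|v|.

Section SquaredNorm.
Context (R : realType) (V : normedModType R[i]).
Implicit Types u v : V.

Lemma normE v : `|v| = (rnorm v)%:C%C.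
Proof. by rewrite /rnorm RRe_real// ger0_real. Qed.

Lemma rnorm_ge0 v : 0 <= rnorm v.
Proof. by rewrite -ler0c -normE. Qed.

Lemma ler_rnormD u v : rnorm (u + v) <= rnorm u + rnorm v.
Proof. by rewrite -lecR rmorphD/= -!normE ler_normD. Qed.

Lemma rnormN v : rnorm (- v) = rnorm v.
Proof. by rewrite /rnorm normrN. Qed.

Lemma ler_dist_rnorm u v : `|rnorm u - rnorm v| <= rnorm (u - v).
Proof.
have h1 := ler_rnormD (u - v) v; have h2 := ler_rnormD (v - u) u.
rewrite !subrK in h1 h2; rewrite -(rnormN (v - u)) opprB in h2.
by rewrite ler_norml; apply/andP; split; lra.
Qed.

Lemma sqnormE v : sqnorm v = rnorm v ^+ 2. Proof. by []. Qed.

Lemma sqnorm_ge0 v : 0 <= sqnorm v. Proof. exact: sqr_ge0. Qed.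

Lemma sqnorm0 : sqnorm (0 : V) = 0.
Proof. by rewrite /sqnorm normr0 expr0n. Qed.

Lemma sqnormZ (c : R[i]) v : sqnorm (c *: v) = sqnorm (c : R[i]^o) * sqnorm v.
Proof.
rewrite !sqnormE -exprMn; congr (_ ^+ 2).
by apply: complexI; rewrite rmorphM/= -!normE normrZ.
Qed.

Lemma rnorm_continuous : continuous (@rnorm R V).
Proof.
move=> v; apply/cvgrPdist_lt => e e0.
have /(_ _ e%:C%C) :=
  (@cvgrPdist_lt _ V _ (nbhs v) _ id v).1 (@cvg_id _ (nbhs v)).
rewrite ltcR => /(_ e0); apply: filterS => u.
by rewrite normE ltcR; apply: le_lt_trans; exact: ler_dist_rnorm.
Qed.

Lemma sqnorm_continuous : continuous (@sqnorm R V).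
Proof.
move=> v.
rewrite /continuous_at (_ : @sqnorm R V = @rnorm R V \* @rnorm R V).
  by apply: cvgM; exact: rnorm_continuous.
exact/funext.
Qed.

(** Young's inequality.  It replaces the triangle inequality for square roots
    of integrals, so that only squared norms are ever integrated. *)
Lemma sqnorm_young t u v : 0 < t ->
  sqnorm (u + v) <= (1 + t) * sqnorm u + (1 + t^-1) * sqnorm v.
Proof.
move=> t0; rewrite !sqnormE.
have h := ler_rnormD u v; have hu := rnorm_ge0 u; have hv := rnorm_ge0 v.
apply: (@le_trans _ _ ((rnorm u + rnorm v) ^+ 2)).
  by rewrite ler_sqr// ?nnegrE ?rnorm_ge0// addr_ge0.
have t_neq0 : t != 0 by rewrite gt_eqF.
rewrite -subr_ge0 (_ : _ - _ = t^-1 * (t * rnorm u - rnorm v) ^+ 2).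
  by rewrite mulr_ge0 ?sqr_ge0// invr_ge0 ltW.
by field.
Qed.

End SquaredNorm.

Section ComplexSquaredNorm.
Context (R : realType).

Lemma sqnormC (z : R[i]^o) : sqnorm z = complex.Re z ^+ 2 + complex.Im z ^+ 2.
Proof. by apply: complexI; rewrite add_Re2_Im2 sqnormE rmorphXn/= -normE. Qed.

Lemma rnormC (x : R) : rnorm (x%:C%C : R[i]^o) = `|x|.
Proof.
by rewrite /rnorm normc_def/= expr0n addr0 sqrtr_sqr.
Qed.

(** A positive element of R[i] is real, so the radii in R[i] that define
    convergence of complex numbers are radii in R. *)
Lemma cvg_real_complex (T : Type) (F : set_system T) (FF : Filter F)
    (u : T -> R) (x : R) :
  u @ F --> x -> (fun t => (u t)%:C%C : R[i]^o) @ F --> (x%:C%C : R[i]^o).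
Proof.
move=> /cvgrPdist_lt ux; apply/cvgrPdist_lt => e.
rewrite ltcE/= => /andP[/eqP e1 e2].
have -> : e = (complex.Re e)%:C%C by case: e e1 e2 => a b /= ->.
apply: filterS (ux _ e2) => t.
by rewrite -(rmorphB (real_complex R)) (@normE _ R[i]^o) rnormC ltcR.
Qed.

Lemma cvg_complex (T : Type) (F : set_system T) (FF : Filter F)
    (u v : T -> R) (x y : R) : u @ F --> x -> v @ F --> y ->
  (fun t => Complex (u t) (v t) : R[i]^o) @ F --> (Complex x y : R[i]^o).
Proof.
move=> ux vy.
have E a b : Complex a b = a%:C%C + ('i)%C * b%:C%C :> R[i].
  by apply/eqP; rewrite eq_complex/=; apply/andP; split; apply/eqP; ring.
rewrite E (_ : (fun t => _) =
  (fun t => (u t)%:C%C + ('i)%C * (v t)%:C%C)); last exact/funext.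
apply: (@cvgD _ R[i]^o); first exact: cvg_real_complex.
apply: (@cvgZr _ R[i]^o); exact: cvg_real_complex.
Qed.

Lemma ler_norm_Re (z : R[i]^o) : `|complex.Re z| <= rnorm z.
Proof.
rewrite -ler_sqr ?nnegrE ?rnorm_ge0// -sqnormE sqnormC real_normK ?num_real//.
by rewrite lerDl sqr_ge0.
Qed.

Lemma ler_norm_Im (z : R[i]^o) : `|complex.Im z| <= rnorm z.
Proof.
rewrite -ler_sqr ?nnegrE ?rnorm_ge0// -sqnormE sqnormC real_normK ?num_real//.
by rewrite lerDr sqr_ge0.
Qed.

Lemma cvg_Re (T : Type) (F : set_system T) (FF : Filter F)
    (u : T -> R[i]^o) (z : R[i]^o) :
  u @ F --> z -> (fun t => complex.Re (u t)) @ F --> complex.Re z.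
Proof.
move=> /cvgrPdist_lt uz; apply/cvgrPdist_lt => e e0.
have : 0 < e%:C%C :> R[i] by rewrite ltcR.
move=> /uz; apply: filterS => t.
rewrite (@normE _ R[i]^o) ltcR; apply: le_lt_trans.
rewrite (_ : complex.Re z - _ = complex.Re (z - u t)) ?ler_norm_Re//.
by case: z (u t) {uz} => [? ?] [].
Qed.

Lemma cvg_Im (T : Type) (F : set_system T) (FF : Filter F)
    (u : T -> R[i]^o) (z : R[i]^o) :
  u @ F --> z -> (fun t => complex.Im (u t)) @ F --> complex.Im z.
Proof.
move=> /cvgrPdist_lt uz; apply/cvgrPdist_lt => e e0.
have : 0 < e%:C%C :> R[i] by rewrite ltcR.
move=> /uz; apply: filterS => t.
rewrite (@normE _ R[i]^o) ltcR; apply: le_lt_trans.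
rewrite (_ : complex.Im z - _ = complex.Im (z - u t)) ?ler_norm_Im//.
by case: z (u t) {uz} => [? ?] [].
Qed.

End ComplexSquaredNorm.

(** * Strongly measurable functions *)

Section SimpleFunctions.
Context d (X : measurableType d).

Lemma simple_function_preimage (U : Type) (s : X -> U) (P : set U) :
  simple_function s -> measurable (s @^-1` P).
Proof.
move=> [fs ms].
rewrite (_ : _ @^-1` _ = \bigcup_(u in range s `&` P) (s @^-1` [set u])).
  apply: fin_bigcup_measurable => //; exact: finite_setIl.
apply/seteqP; split => [x Px|x [u [_ Pu] /= ->]//].
by exists (s x) => //; split => //; exists x.
Qed.

Lemma simple_function_comp (U V : Type) (F : U -> V) (s : X -> U) :
  simple_function s -> simple_function (F \o s).
Proof.
move=> hs; split => [|v].
  apply: sub_finite_set (finite_image F hs.1) => _ [x _ <-].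
  by exists (s x) => //; exists x.
by rewrite comp_preimage; exact: simple_function_preimage.
Qed.

Lemma simple_function_pair (U V : Type) (s : X -> U) (t : X -> V) :
  simple_function s -> simple_function t ->
  simple_function (fun x => (s x, t x)).
Proof.
move=> [fs ms] [ft mt]; split => [|[u v]].
  apply: sub_finite_set (finite_setX fs ft) => _ [x _ <-].
  by split; exists x.
rewrite (_ : _ @^-1` _ = s @^-1` [set u] `&` t @^-1` [set v]).
  exact: measurableI.
by apply/seteqP; split => x /=; [case=> -> ->|case=> -> ->].
Qed.

(** Every binary operation preserves simple functions, whatever its
    regularity; sums and products of strongly measurable functions then only
    need continuity at the limit. *)
Lemma simple_function_comp2 (U V W : Type) (F : U -> V -> W) s t :
  simple_function s -> simple_function t ->
  simple_function (fun x : X => F (s x) (t x)).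
Proof.
move=> hs ht.
exact: (simple_function_comp (fun p => F p.1 p.2) (simple_function_pair hs ht)).
Qed.

Lemma simple_function_cst (U : Type) (u : U) : simple_function (fun _ : X => u).
Proof.
split => [|v].
  by apply: (sub_finite_set _ (finite_set1 u)) => _ [x _ <-].
have [->|uv] := pselect (u = v).
  by rewrite (_ : _ @^-1` _ = setT)//; exact/seteqP.
by rewrite (_ : _ @^-1` _ = set0)//; apply/seteqP; split.
Qed.

End SimpleFunctions.

Section StrongMeasurability.
Context d (X : measurableType d) (R : realType).

Lemma strongly_measurable_cst (V : normedModType R[i]) (v : V) :
  strongly_measurable (fun _ : X => v).
Proof.
exists (fun=> fun=> v); split => [_|x]; first exact: simple_function_cst.
exact: cvg_cst.
Qed.

Lemma strongly_measurableD (V : normedModType R[i]) (f g : X -> V) :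
  strongly_measurable f -> strongly_measurable g ->
  strongly_measurable (fun x => f x + g x).
Proof.
move=> [s [hs sf]] [t [ht tg]].
exists (fun n x => s n x + t n x); split => [n|x].
  exact: (simple_function_comp2 +%R (hs n) (ht n)).
exact: cvgD.
Qed.

Lemma strongly_measurableB (V : normedModType R[i]) (f g : X -> V) :
  strongly_measurable f -> strongly_measurable g ->
  strongly_measurable (f - g).
Proof.
move=> [s [hs sf]] [t [ht tg]].
exists (fun n x => s n x - t n x); split => [n|x].
  exact: (simple_function_comp2 (fun a b : V => a - b) (hs n) (ht n)).
exact: cvgB.
Qed.

Lemma strongly_measurableZ (V : normedModType R[i]) (f : X -> R[i]^o)
    (g : X -> V) :
  strongly_measurable f -> strongly_measurable g ->
  strongly_measurable (fun x => f x *: g x).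
Proof.
move=> [s [hs sf]] [t [ht tg]].
exists (fun n x => s n x *: t n x); split => [n|x].
  exact: (simple_function_comp2 (fun (a : R[i]) (b : V) => a *: b)
    (hs n) (ht n)).
exact: cvgZ.
Qed.

Lemma strongly_measurable_sum (V : normedModType R[i]) (I : Type) (s : seq I)
    (f : I -> X -> V) :
  (forall i, strongly_measurable (f i)) ->
  strongly_measurable (fun x => \sum_(i <- s) f i x).
Proof.
move=> hf; elim: s => [|i s IH].
  rewrite (_ : (fun _ => _) = fun=> 0); first exact: strongly_measurable_cst.
  by apply/funext => x; rewrite big_nil.
rewrite (_ : (fun _ => _) = fun x => f i x + \sum_(i <- s) f i x).
  exact: strongly_measurableD.
by apply/funext => x; rewrite big_cons.
Qed.

Lemma simple_function_measurable (s : X -> R) :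
  simple_function s -> measurable_fun setT s.
Proof. by move=> hs _ Y _; rewrite setTI; exact: simple_function_preimage. Qed.

Lemma strongly_measurable_sqnorm (V : normedModType R[i]) (f : X -> V) :
  strongly_measurable f -> measurable_fun setT (fun x => sqnorm (f x)).
Proof.
move=> [s [hs sf]]; apply: (@measurable_fun_cvg _ _ _ _
  (fun n x => sqnorm (s n x))) => [n|x _].
  exact/simple_function_measurable/(simple_function_comp (@sqnorm R V)).
exact: continuous_cvg (@sqnorm_continuous R V _) (sf x).
Qed.

Lemma strongly_measurable_Re (f : X -> R[i]^o) : strongly_measurable f ->
  measurable_fun setT (fun x => complex.Re (f x)).
Proof.
move=> [s [hs sf]]; apply: (@measurable_fun_cvg _ _ _ _
  (fun n x => complex.Re (s n x))) => [n|x _]; last exact: cvg_Re.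
exact/simple_function_measurable/(simple_function_comp (@complex.Re R)).
Qed.

Lemma strongly_measurable_Im (f : X -> R[i]^o) : strongly_measurable f ->
  measurable_fun setT (fun x => complex.Im (f x)).
Proof.
move=> [s [hs sf]]; apply: (@measurable_fun_cvg _ _ _ _
  (fun n x => complex.Im (s n x))) => [n|x _]; last exact: cvg_Im.
exact/simple_function_measurable/(simple_function_comp (@complex.Im R)).
Qed.

Import HBSimple.

(** Real measurable functions are pointwise limits of real simple functions,
    which are complex simple functions as well. *)
Lemma strongly_measurable_real (u : X -> R) : measurable_fun setT u ->
  strongly_measurable (fun x => (u x)%:C%C : R[i]^o).
Proof.
move=> /measurable_EFinP mu; have [s su] := approximation_sfun measurableT mu.
exists (fun n x => (s n x)%:C%C); split => [n|x].
  apply: (simple_function_comp (real_complex R)); split => [|v].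
    exact: fimfunP.
  by rewrite -[X in measurable X]setTI; exact: measurable_funP.
apply: cvg_real_complex; exact: (fine_cvg (su x I)).
Qed.

End StrongMeasurability.

(** * Comparing functions through their integrals *)

Section IntegralComparison.
Context d (X : measurableType d) (R : realType)
  (mu : {measure set X -> \bar R}).

Import HBNNSimple.

(** Measurability is not assumed: the integral of a nonnegative function is the
    supremum over the simple functions below it, and such a simple function may
    be set to 0 on a null set without changing its integral.  This is what
    allows integrating [summability.sum], which takes an arbitrary value at the
    points of divergence. *)
Lemma ge0_ae_le_integral (f g : X -> \bar R) :
  (forall x, 0 <= f x)%E -> (forall x, 0 <= g x)%E ->
  {ae mu, forall x, (f x <= g x)%E} ->
  (\int[mu]_x f x <= \int[mu]_x g x)%E.
Proof.
move=> f0 g0 [N [mN N0 fgN]].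
rewrite !ge0_integralTE//= ge_ereal_sup// => _ [h/= hf] <-.
pose h' := mul_nnsfun h (indic_nnsfun R (measurableC mN)).
apply: le_ereal_sup_tmp; exists (sintegral mu h').
  exists h' => // x; rewrite (_ : h' x = h x * \1_(~` N) x)// indicE.
  have [xN|xN] := pselect (N x).
    by rewrite memNset ?mulr0//; exact.
  rewrite mem_set// mulr1 (le_trans (hf x))//.
  by apply: contrapT => /fgN.
rewrite -!integralT_nnsfun le_eqVlt; apply/orP; left; apply/eqP.
apply: ge0_ae_eq_integral => //=.
- by apply/measurable_EFinP; exact: (measurable_funP h).
- by apply/measurable_EFinP; exact: (measurable_funP h').
- by move=> x _; rewrite lee_fin.
- by move=> x _; rewrite lee_fin mulr_ge0.
exists N; split => // x /= hx; apply: contrapT => xN; apply: hx => _.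
by rewrite [mindic _ _ _]indicE mem_set// mulr1.
Qed.

Hypothesis mu_fin : (mu setT < +oo)%E.

(** The set where v < u is the union of the sets E n below.  On E n the
    integral of v is finite and u exceeds v by 1/(n+1), so that E n is null. *)
Lemma ae_le_of_setintegral_le (u v : X -> R) :
  measurable_fun setT u -> measurable_fun setT v ->
  (forall x, 0 <= u x) -> (forall x, 0 <= v x) ->
  (forall E, measurable E ->
    (\int[mu]_(x in E) (u x)%:E <= \int[mu]_(x in E) (v x)%:E)%E) ->
  {ae mu, forall x, u x <= v x}.
Proof.
move=> mu_ mv u0 v0 uv.
(* The cap on v makes its integral over E n finite. *)
pose E n := [set x | v x + n.+1%:R^-1 <= u x] `&` [set x | v x <= n.+1%:R].
have mE n : measurable (E n).
  apply: measurableI; rewrite -[X in measurable X]setTI.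
    by apply: measurable_fun_le => //; apply: measurable_funD.
  by apply: measurable_fun_le.
have E0 n : mu (E n) = 0%E.
  have fE : (mu (E n) < +oo)%E.
    by rewrite (le_lt_trans _ mu_fin)// le_measure ?inE.
  have mEu (w : X -> R) : measurable_fun setT w ->
      measurable_fun (E n) (EFin \o w).
    by move=> mw; apply/measurable_EFinP; exact: measurable_funS mw.
  have vfin : (\int[mu]_(x in E n) (v x)%:E < +oo)%E.
    apply: (@le_lt_trans _ _ (\int[mu]_(x in E n) (n.+1%:R)%:E)%E).
      apply: ge0_le_integral => //; [|exact: mEu|].
        by move=> x _; rewrite lee_fin.
      by move=> x [_ /=]; rewrite lee_fin.
    by rewrite integral_cst//= lte_mul_pinfty.
  have h : (\int[mu]_(x in E n) (v x)%:E + (n.+1%:R^-1)%:E * mu (E n) <=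
      \int[mu]_(x in E n) (v x)%:E)%E.
    rewrite -integral_cst// -ge0_integralD//=; last 2 first.
      by move=> x _; rewrite lee_fin.
      exact: mEu.
    apply: le_trans (uv _ (mE n)); apply: ge0_le_integral => //.
    - by move=> x _; rewrite -EFinD lee_fin addr_ge0.
    - by apply: emeasurable_funD => //; exact: mEu.
    - exact: mEu.
    - by move=> x [/= ? _]; rewrite -EFinD lee_fin.
  have vge0 : (0 <= \int[mu]_(x in E n) (v x)%:E)%E.
    by apply: integral_ge0 => x _; rewrite lee_fin.
  move: h; rewrite -[leRHS]adde0 leeD2lE; last by rewrite ge0_fin_numE.
  rewrite pmule_rle0 ?lte_fin// => h.
  by apply/eqP; rewrite eq_le h measure_ge0.
apply: (@negligibleS _ _ _ _ (\bigcup_n E n)); last first.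
  by apply: negligible_bigcup => n; apply/negligibleP; [exact: mE|exact: E0].
move=> x /= /negP; rewrite -ltNge => vu.
have [n nv] : exists n : nat, v x <= n.+1%:R.
  by exists (Num.truncn (v x)); exact/ltW/truncnS_gt.
have [m hm] := ltr_add_invr vu.
exists (maxn n m) => //; split => /=.
- rewrite (le_trans _ (ltW hm))// lerD2l lef_pV2 ?posrE// ler_nat ltnS.
  exact: leq_maxr.
- by rewrite (le_trans nv)// ler_nat ltnS leq_maxl.
Qed.

End IntegralComparison.

Section DenseWeights.
Context d (X : measurableType d) (R : realType)
  (mu : {measure set X -> \bar R}).

Lemma measurable_sqnormM (V : normedModType R[i]) (f : X -> V) (w : X -> R) :
  strongly_measurable f -> measurable_fun setT w ->
  measurable_fun setT (fun x => (sqnorm (f x) * w x)%:E).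
Proof.
move=> mf mw; apply/measurable_EFinP; apply: measurable_funM => //.
exact: strongly_measurable_sqnorm.
Qed.

Lemma sqnormL2N (V : normedModType R[i]) (f : X -> V) :
  sqnormL2 mu (- f) = sqnormL2 mu f.
Proof. by apply: eq_integral => x _; rewrite !sqnormE rnormN. Qed.

(** [sqnorm_young] integrated against a bounded weight.  As t tends to 0 it says
    that h |-> int |h|^2 w is continuous on L^2(X). *)
Lemma weighted_sqnorm_le (f g : X -> R[i]^o) (w : X -> R) (t M : R) :
  strongly_measurable f -> strongly_measurable g ->
  measurable_fun setT w -> (forall x, 0 <= w x) ->
  {ae mu, forall x, w x <= M} -> 0 <= M -> 0 < t ->
  (\int[mu]_x (sqnorm (f x) * w x)%:E <=
   (1 + t)%:E * \int[mu]_x (sqnorm (g x) * w x)%:E +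
   ((1 + t^-1) * M)%:E * sqnormL2 mu (f - g)%R)%E.
Proof.
move=> mf mg mw w0 wM M0 t0.
have t1 : 0 <= 1 + t by rewrite addr_ge0// ltW.
have t2 : 0 <= 1 + t^-1 by rewrite addr_ge0// invr_ge0 ltW.
have mfg := strongly_measurableB mf mg.
have msfg : measurable_fun setT (fun x => (sqnorm ((f - g) x))%:E).
  by apply/measurable_EFinP; exact: strongly_measurable_sqnorm.
rewrite -ge0_integralZl_EFin//; last 2 first.
- by move=> x _; rewrite lee_fin mulr_ge0// sqnorm_ge0.
- exact: measurable_sqnormM.
rewrite /sqnormL2 -ge0_integralZl_EFin//; last 2 first.
- by move=> x _; rewrite lee_fin sqnorm_ge0.
- by rewrite mulr_ge0.
rewrite -ge0_integralD//; last 4 first.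
- by move=> x _; rewrite -EFinM lee_fin mulr_ge0// mulr_ge0// sqnorm_ge0.
- by apply: emeasurable_funM => //; exact: measurable_sqnormM.
- by move=> x _; rewrite -EFinM lee_fin mulr_ge0 ?sqnorm_ge0 ?mulr_ge0.
- by apply: emeasurable_funM.
apply: ge0_ae_le_integral => [x|x|].
- by rewrite lee_fin mulr_ge0// sqnorm_ge0.
- by rewrite -!EFinM -EFinD lee_fin addr_ge0// mulr_ge0 ?sqnorm_ge0//
    mulr_ge0// sqnorm_ge0.
apply: filterS wM => x wM; rewrite -!EFinM -EFinD lee_fin.
have := sqnorm_young (g x) ((f - g) x) t0.
rewrite [in X in X <= _](_ : g x + (f - g) x = f x); last exact: subrKC.
move=> /(ler_wpM2r (w0 x)) /le_trans; apply.
rewrite [leLHS]mulrDl -mulrA lerD2l mulrAC; apply: ler_wpM2r.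
  exact: sqnorm_ge0.
exact: ler_wpM2l.
Qed.

Hypothesis mu_fin : (mu setT < +oo)%E.

Let ind E : X -> R[i]^o := fun x => (\1_E x : R)%:C%C.

Lemma strongly_measurable_indic E : measurable E -> strongly_measurable (ind E).
Proof. by move=> mE; apply: strongly_measurable_real. Qed.

Lemma sqnorm_indic E x : sqnorm (ind E x) = \1_E x.
Proof.
rewrite sqnormC/= expr0n addr0 indicE.
by case: (x \in E); rewrite ?expr0n ?expr1n.
Qed.

Lemma setintegral_indic E (w : X -> R) :
  (\int[mu]_(x in E) (w x)%:E)%E = (\int[mu]_x (sqnorm (ind E x) * w x)%:E)%E.
Proof.
rewrite integral_mkcond; apply: eq_integral => x _.
by rewrite patchE sqnorm_indic indicE; case: ifP; rewrite ?mul1r ?mul0r.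
Qed.

Lemma setintegral_bounded_lty E (w : X -> R) (M : R) : measurable E ->
  measurable_fun setT w -> (forall x, 0 <= w x) ->
  {ae mu, forall x, w x <= M} -> (\int[mu]_(x in E) (w x)%:E < +oo)%E.
Proof.
move=> mE mw w0 wM.
apply: (@le_lt_trans _ _ (\int[mu]_x (Num.max 0 M)%:E)%E).
  rewrite integral_mkcond; apply: ge0_ae_le_integral => [x|x|].
  - by rewrite patchE; case: ifP; rewrite ?lee_fin.
  - by rewrite lee_fin le_max lexx.
  - apply: filterS wM => x wM.
    by rewrite patchE; case: ifP; rewrite ?lee_fin le_max ?wM ?orbT ?lexx.
by rewrite integral_cst//= lte_mul_pinfty// lee_fin le_max lexx.
Qed.

(** Approximating 1_E by h in Q compares the integrals of w1 and w2 over E.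
    The continuity of h |-> int |h|^2 w1 is only available for bounded
    weights, whence the truncation of w1 at the integers k. *)
Lemma ae_le_of_dense_weights (Q : set (X -> R[i]^o)) (w1 w2 : X -> R) (M : R) :
  (forall h, Q h -> strongly_measurable h) ->
  (forall E, measurable E -> forall e : R, 0 < e ->
    exists2 h, Q h & (sqnormL2 mu (ind E - h)%R < e%:E)%E) ->
  measurable_fun setT w1 -> measurable_fun setT w2 ->
  (forall x, 0 <= w1 x) -> (forall x, 0 <= w2 x) ->
  {ae mu, forall x, w2 x <= M} ->
  (forall h, Q h -> (\int[mu]_x (sqnorm (h x) * w1 x)%:E <=
                     \int[mu]_x (sqnorm (h x) * w2 x)%:E)%E) ->
  {ae mu, forall x, w1 x <= w2 x}.
Proof.
move=> mQ dQ mw1 mw2 w10 w20 w2M' Qw.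
wlog M0 : M w2M' / 0 <= M.
  apply; last exact: (normr_ge0 M).
  by apply: filterS w2M' => x /le_trans; apply; exact: ler_norm.
pose u k x := Num.min (w1 x) k%:R.
have mu_ k : measurable_fun setT (u k) by apply: measurable_minr.
have u0 k x : 0 <= u k x by rewrite le_min w10 ler0n.
suff: {ae mu, forall x, forall k, u k x <= w2 x}.
  apply: filterS => x /(_ (Num.truncn (w1 x)).+1).
  by rewrite /u min_l//; exact/ltW/truncnS_gt.
apply/ae_foralln => k; apply: ae_le_of_setintegral_le => // E mE.
have mi := strongly_measurable_indic mE.
have := setintegral_bounded_lty mE mw2 w20 w2M'.
have : (0 <= \int[mu]_(x in E) (w2 x)%:E)%E.
  by apply: integral_ge0 => x _; rewrite lee_fin.
case Eb : (\int[mu]_(x in E) (w2 x)%:E)%E => [b| |]// b0 _.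
rewrite lee_fin in b0.
apply/lee_addgt0Pr => e e0.
(* For t <= 1 one has (1 + t)^2 b + t <= b + t (3 b + 1); the remaining
   error is at most D times the squared distance of h to 1_E, hence at most t. *)
pose t := Num.min 1 (e / (3 * b + 1)).
have b1 : 0 < 3 * b + 1 by rewrite ltr_wpDl// mulr_ge0.
have t0 : 0 < t by rewrite lt_min ltr01 divr_gt0.
have t1 : t <= 1 by rewrite ge_min lexx.
have te : t * (3 * b + 1) <= e by rewrite -ler_pdivlMr// ge_min lexx orbT.
pose K := (1 + t^-1) * k%:R; pose L := (1 + t^-1) * M.
have K0 : 0 <= K by rewrite mulr_ge0// addr_ge0// invr_ge0 ltW.
have L0 : 0 <= L by rewrite mulr_ge0// addr_ge0// invr_ge0 ltW.
have t10 : 0 <= 1 + t by rewrite addr_ge0// ltW.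
pose D := (1 + t) * L + K + 1.
have D0 : 0 < D by rewrite ltr_wpDl// addr_ge0// mulr_ge0.
have [h Qh hE] := dQ E mE (t / D) (divr_gt0 t0 D0).
have mh := mQ h Qh.
have uk : {ae mu, forall x, u k x <= k%:R}.
  by apply: aeW => x; rewrite ge_min lexx orbT.
have h1 := weighted_sqnorm_le mi mh (mu_ k) (u0 k) uk (ler0n _ _) t0.
have h2 := weighted_sqnorm_le mh mi mw2 w20 w2M' M0 t0.
rewrite -sqnormL2N opprB -setintegral_indic Eb in h2.
rewrite setintegral_indic.
have h3 : (\int[mu]_x (sqnorm (h x) * u k x)%:E <=
           \int[mu]_x (sqnorm (h x) * w1 x)%:E)%E.
  apply: ge0_ae_le_integral => [x|x|].
  - by rewrite lee_fin mulr_ge0// sqnorm_ge0.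
  - by rewrite lee_fin mulr_ge0// sqnorm_ge0.
  - by apply: aeW => x; rewrite lee_fin ler_wpM2l ?sqnorm_ge0// ge_min lexx.
apply: (le_trans h1).
have h4 := le_trans h3 (le_trans (Qw h Qh) h2).
have N0 := ltW hE.
apply: (@le_trans _ _ ((1 + t)%:E * ((1 + t)%:E * b%:E + L%:E * (t / D)%:E) +
    K%:E * (t / D)%:E)%E).
  apply: leeD; last by rewrite lee_wpmul2l ?lee_fin.
  rewrite lee_wpmul2l ?lee_fin//; apply: (le_trans h4).
  by rewrite leeD2l// lee_wpmul2l ?lee_fin.
rewrite -!EFinM -!EFinD lee_fin.
have tD : D * (t / D) = t by rewrite mulrC divfK// gt_eqF.
apply: le_trans (_ : (1 + t) * (1 + t) * b + D * (t / D) <= _).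
  have := divr_ge0 (ltW t0) (ltW D0); rewrite /D; move: (t / _) => q q0.
  nra.
rewrite tD; have : t * t <= t by rewrite ler_piMl// ltW.
move=> tt; have : t * t * b <= t * b by rewrite ler_wpM2r.
nra.
Qed.

End DenseWeights.

(** * Finitely supported sums *)

Section FiniteSums.

Lemma finite_support_seq (I : choiceType) (V : zmodType) (c : I -> V) :
  finite_set [set i | c i != 0] ->
  exists2 r : seq I, uniq r & forall i, i \notin r -> c i = 0.
Proof.
move=> /finite_seqP[r rE]; exists (undup r); first exact: undup_uniq.
move=> i; rewrite mem_undup => ir; apply/eqP; apply/negPn/negP => ci.
have : [set` r] i by rewrite -rE.
by rewrite /= (negPf ir).
Qed.

Lemma fsum_seq (I : choiceType) (V : nmodType) (r : seq I) (F : I -> V) :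
  uniq r -> (forall i, i \notin r -> F i = 0) ->
  \sum_(i \in [set: I]) F i = \sum_(i <- r) F i.
Proof.
move=> ur Fr; rewrite (fsbigE r)//; last by move=> i _; exact: Fr.
by apply: eq_bigl => i; rewrite in_setT.
Qed.

Lemma fsum_scale_seq (R : realType) (I : choiceType) (V : lmodType R[i])
    (r : seq I) (c : I -> R[i]) (u : I -> V) :
  uniq r -> (forall i, i \notin r -> c i = 0) ->
  \sum_(i \in [set: I]) c i *: u i = \sum_(i <- r) c i *: u i.
Proof. by move=> ur cr; apply: fsum_seq => // i /cr ->; rewrite scale0r. Qed.

Lemma fsum_sqnorm_seq (R : realType) (I : choiceType) (r : seq I)
    (c : I -> R[i]) :
  uniq r -> (forall i, i \notin r -> c i = 0) ->
  \sum_(i \in [set: I]) sqnorm (c i : R[i]^o) =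
  \sum_(i <- r) sqnorm (c i : R[i]^o).
Proof. by move=> ur cr; apply: fsum_seq => // i /cr ->; rewrite sqnorm0. Qed.

Lemma fsum_sqnorm_ge0 (R : realType) (I : choiceType) (c : I -> R[i]) :
  0 <= \sum_(i \in [set: I]) sqnorm (c i : R[i]^o).
Proof. by apply: fsumr_ge0 => i _; exact: sqnorm_ge0. Qed.

Lemma fsum_pair_seq (I J : choiceType) (V : nmodType) (r : seq I) (s : seq J)
    (F : I * J -> V) :
  uniq r -> uniq s -> (forall p, p.1 \notin r -> F p = 0) ->
  (forall p, p.2 \notin s -> F p = 0) ->
  \sum_(p \in [set: I * J]) F p = \sum_(i <- r) \sum_(j <- s) F (i, j).
Proof.
move=> ur us Fr Fs; rewrite (@fsum_seq _ _ [seq (i, j) | i <- r, j <- s]).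
- by rewrite big_allpairs.
- by apply: allpairs_uniq => // -[? ?] [? ?].
- move=> [i j] ij; have [ir|ir] := boolP (i \in r); last exact: Fr.
  apply: Fs; apply: contraNN ij => /= js.
  by apply/allpairsP; exists (i, j).
Qed.

End FiniteSums.

Lemma cvg_sum_seq (K : numFieldType) (V : normedModType K) (T I : Type)
    (F : set_system T) (FF : Filter F) (r : seq I) (f : I -> T -> V)
    (a : I -> V) :
  (forall i, f i @ F --> a i) ->
  (fun t => \sum_(i <- r) f i t) @ F --> \sum_(i <- r) a i.
Proof.
move=> fa; elim: r => [|i r IH].
  by rewrite big_nil; under eq_fun do rewrite big_nil; exact: cvg_cst.
by rewrite big_cons; under eq_fun do rewrite big_cons; exact: cvgD.
Qed.

(** * From rational coefficients to all coefficients *)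

Section Density.
Context (R : realType) (J : countType).

(** A countable set of finitely supported families: the entries of [s] list
    positions with the real and imaginary parts to be added there. *)
Definition rat_coeff (s : seq (J * (rat * rat))) (j : J) : R[i] :=
  \sum_(p <- s | p.1 == j) Complex (ratr p.2.1) (ratr p.2.2).

Lemma rat_coeff_finite s : finite_set [set j | rat_coeff s j != 0].
Proof.
apply: sub_finite_set (finite_seq (map fst s)) => j /=.
apply: contraNP => /negP js.
rewrite /rat_coeff big1_seq// => p /andP[/eqP pj ps].
by move: js; rewrite -pj map_f.
Qed.

Lemma rat_approx (x : R) (n : nat) : exists q : rat, `|ratr q - x| < n.+1%:R^-1.
Proof.
have n0 : 0 < n.+1%:R^-1 :> R by [].
have [|q] := @rat_in_itvoo R (x - n.+1%:R^-1) (x + n.+1%:R^-1).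
  by rewrite ltrD2l gtrN.
by rewrite in_itv/= => /andP[q1 q2]; exists q; rewrite ltr_distl q1 q2.
Qed.

Lemma rat_approx_seq (x : R) :
  exists q : nat -> rat, (fun n => ratr (q n)) @ \oo --> x.
Proof.
have /choice[q hq] := rat_approx x; exists q.
apply/cvgrPdist_lt => e e0; near=> n.
rewrite distrC (lt_trans (hq n))//.
near: n; exact: near_infty_natSinv_lt (PosNum e0).
Unshelve. all: by end_near. Qed.

(** For a fixed finite support, both sides of the Riesz inequalities are
    continuous in the coefficients. *)
Lemma riesz_sequence_in_of_rat (V : normedModType R[i]) (u : J -> V) (A B : R) :
  0 < A -> A <= B ->
  (forall s, let c := rat_coeff s in
    A * \sum_(j \in [set: J]) sqnorm (c j : R[i]^o) <=
      sqnorm (\sum_(j \in [set: J]) c j *: u j) <=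
    B * \sum_(j \in [set: J]) sqnorm (c j : R[i]^o)) ->
  riesz_sequence_in u A B.
Proof.
move=> A0 AB H; split => [|//|c fc /=]; first by rewrite A0.
have [r ur cr] := finite_support_seq fc.
rewrite (fsum_sqnorm_seq ur cr) (fsum_scale_seq u ur cr).
have /choice[p hp] := fun j => rat_approx_seq (complex.Re (c j)).
have /choice[q hq] := fun j => rat_approx_seq (complex.Im (c j)).
(* As [r] is duplicate-free, each position receives a single entry. *)
pose d n := rat_coeff [seq (j, (p j n, q j n)) | j <- r].
have dr n j : j \in r -> d n j = Complex (ratr (p j n)) (ratr (q j n)).
  move=> jr; rewrite /d /rat_coeff big_map big_mkcond (bigD1_seq j)//= eqxx.
  by rewrite big1 ?addr0// => i /negPf ->.
have d0 n j : j \notin r -> d n j = 0.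
  move=> jr; rewrite /d /rat_coeff big_map big1_seq// => i /= /andP[/eqP -> ir].
  by rewrite ir in jr.
have dc j : (fun n => d n j : R[i]^o) @ \oo --> (c j : R[i]^o).
  have [jr|jr] := boolP (j \in r); last first.
    by rewrite cr//; under eq_fun do rewrite d0//; exact: cvg_cst.
  under eq_fun do rewrite dr//.
  have -> : c j = Complex (complex.Re (c j)) (complex.Im (c j)) by case: (c j).
  exact: cvg_complex.
have cvg1 : (fun n => \sum_(j <- r) sqnorm (d n j : R[i]^o)) @ \oo -->
    \sum_(j <- r) sqnorm (c j : R[i]^o).
  apply: (@cvg_sum_seq _ R^o) => j.
  exact: continuous_cvg (@sqnorm_continuous R R[i]^o _) (dc j).
have cvg2 : (fun n => sqnorm (\sum_(j <- r) d n j *: u j)) @ \oo -->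
    sqnorm (\sum_(j <- r) c j *: u j).
  apply: (continuous_cvg _ (@sqnorm_continuous R V _)).
  by apply: cvg_sum_seq => j; apply: cvgZr_tmp; exact: dc.
have cvg3 D : (fun n => D * \sum_(j <- r) sqnorm (d n j : R[i]^o)) @ \oo -->
    D * \sum_(j <- r) sqnorm (c j : R[i]^o) by exact: cvgMl_tmp.
have Hd n := H [seq (j, (p j n, q j n)) | j <- r].
rewrite !lee_fin; split.
- apply: (ler_cvg_to (cvg3 A) cvg2); apply: nearW => n.
  have /andP[+ _] := Hd n.
  by rewrite (fsum_sqnorm_seq ur (d0 n)) (fsum_scale_seq u ur (d0 n)).
- apply: (ler_cvg_to cvg2 (cvg3 B)); apply: nearW => n.
  have /andP[_ +] := Hd n.
  by rewrite (fsum_sqnorm_seq ur (d0 n)) (fsum_scale_seq u ur (d0 n)).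
Qed.

End Density.

Section AlmostEverywhereRiesz.
Context d (X : measurableType d) (R : realType)
  (mu : {measure set X -> \bar R}).

Lemma ae_forall_count (T : countType) (P : T -> X -> Prop) :
  (forall t, {ae mu, forall x, P t x}) -> {ae mu, forall x, forall t, P t x}.
Proof.
move=> aeP.
have : {ae mu, forall x, forall n,
    if @unpickle T n is Some t then P t x else True}.
  by apply/ae_foralln => n; case: unpickle => [t|]; [exact: aeP|exact: aeW].
by apply: filterS => x Px t; have := Px (pickle t); rewrite pickleK.
Qed.

(** The exceptional null set may depend on c in the hypothesis; it is made
    uniform by using countably many c. *)
Lemma ae_riesz_sequence_in (V : normedModType R[i]) (J : countType)
    (phi : J -> X -> V) (A B : R) : 0 < A -> A <= B ->
  (forall c : J -> R[i], finite_set [set j | c j != 0] ->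
    let s := \sum_(j \in [set: J]) sqnorm (c j : R[i]^o) in
    let w x := sqnorm (\sum_(j \in [set: J]) c j *: phi j x) in
    {ae mu, forall x, A * s <= w x} /\ {ae mu, forall x, w x <= B * s}) ->
  {ae mu, forall x, riesz_sequence_in (phi ^~ x) A B}.
Proof.
move=> A0 AB H.
have : {ae mu, forall x, forall s : seq (J * (rat * rat)),
    let c := rat_coeff R s in
    A * \sum_(j \in [set: J]) sqnorm (c j : R[i]^o) <=
      sqnorm (\sum_(j \in [set: J]) c j *: phi j x) <=
    B * \sum_(j \in [set: J]) sqnorm (c j : R[i]^o)}.
  apply: ae_forall_count => s; have [h1 h2] := H _ (rat_coeff_finite R s).
  by apply: filterS2 h1 h2 => x h1 h2; apply/andP.
by apply: filterS => x; exact: riesz_sequence_in_of_rat.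
Qed.

End AlmostEverywhereRiesz.

(** * Orthonormal families in L^2 *)

Section HasIntegral.
Context d (X : measurableType d) (R : realType)
  (mu : {measure set X -> \bar R}).

(** Integrability together with the value of the integral, so that both are
    carried through finite sums at once. *)
Definition has_integral (f : X -> R) (r : R) : Prop :=
  mu.-integrable setT (EFin \o f) /\ (\int[mu]_x (f x)%:E)%E = r%:E.

Lemma has_integralD f g r s : has_integral f r -> has_integral g s ->
  has_integral (fun x => f x + g x) (r + s).
Proof.
move=> [fi fr] [gi gs]; split; first exact: (integrableD measurableT fi gi).
by rewrite EFinD -fr -gs -integralD_EFin.
Qed.

Lemma has_integralZ k f r :
  has_integral f r -> has_integral (fun x => k * f x) (k * r).
Proof.
move=> [fi fr]; split; first exact: (integrableZl measurableT k fi).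
by rewrite EFinM -fr -integralZl.
Qed.

Lemma has_integral_sum (I : Type) (s : seq I) (f : I -> X -> R) (r : I -> R) :
  (forall i, has_integral (f i) (r i)) ->
  has_integral (fun x => \sum_(i <- s) f i x) (\sum_(i <- s) r i).
Proof.
move=> fr; elim: s => [|i s IH].
  rewrite big_nil (_ : (fun _ => _) = cst 0); last first.
    by apply/funext => x; rewrite big_nil.
  by split; [exact: integrable0|exact: integral0].
rewrite big_cons (_ : (fun _ => _) = fun x => f i x + \sum_(j <- s) f j x).
  exact: has_integralD.
by apply/funext => x; rewrite big_cons.
Qed.

Lemma has_integral_Rintegral f : mu.-integrable setT (EFin \o f) ->
  has_integral f (\int[mu]_x f x).
Proof.
by move=> fi; split => //; rewrite fineK//; exact: integrable_fin_num.
Qed.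

Lemma L2_integrable (V : normedModType R[i]) (f : X -> V) : L2 mu f ->
  mu.-integrable setT (EFin \o (fun x => sqnorm (f x))).
Proof.
move=> [mf fi]; apply/integrableP; split.
  by apply/measurable_EFinP; exact: strongly_measurable_sqnorm.
rewrite (le_lt_trans _ fi)// le_eqVlt; apply/orP; left; apply/eqP.
by apply: eq_integral => x _ /=; rewrite ger0_norm ?sqnorm_ge0.
Qed.

Lemma strongly_measurable_conj (f : X -> R[i]^o) : strongly_measurable f ->
  strongly_measurable (fun x => conjC (f x) : R[i]^o).
Proof.
move=> [s [hs sf]]; exists (fun n x => conjC (s n x)); split => [n|x].
  exact: (simple_function_comp conjC (hs n)).
rewrite (_ : (fun n => _) =
  fun n => Complex (complex.Re (s n x)) (- complex.Im (s n x))).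
  have -> : conjC (f x) = Complex (complex.Re (f x)) (- complex.Im (f x)).
    by case: (f x).
  by apply: cvg_complex; [exact: cvg_Re|apply: cvgN; exact: cvg_Im].
by apply/funext => n; case: (s n x).
Qed.

(** Both parts of f times the conjugate of g are at most |f| |g|, hence at most
    |f|^2 + |g|^2. *)
Lemma integrable_Re_Im_mulconj (f g : X -> R[i]^o) : L2 mu f -> L2 mu g ->
  mu.-integrable setT (EFin \o (fun x => complex.Re (f x * conjC (g x)))) /\
  mu.-integrable setT (EFin \o (fun x => complex.Im (f x * conjC (g x)))).
Proof.
move=> Lf Lg; have [mf _] := Lf; have [mg _] := Lg.
have mfg : strongly_measurable (fun x => f x * conjC (g x) : R[i]^o).
  exact: (strongly_measurableZ mf (strongly_measurable_conj mg)).
have ifg := integrableD measurableT (L2_integrable Lf) (L2_integrable Lg).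
have nfg x : rnorm (f x * conjC (g x) : R[i]^o) <= sqnorm (f x) + sqnorm (g x).
  have -> : rnorm (f x * conjC (g x) : R[i]^o) = rnorm (f x) * rnorm (g x).
    by apply: complexI; rewrite rmorphM/= -!normE normrM norm_conjC.
  rewrite !sqnormE; have := rnorm_ge0 (f x); have := rnorm_ge0 (g x).
  have := sqr_ge0 (rnorm (f x) - rnorm (g x)); nra.
split; apply: le_integrable ifg => //.
- by apply/measurable_EFinP; exact: strongly_measurable_Re.
- move=> x _ /=; rewrite lee_fin (le_trans (ler_norm_Re _))//.
  by rewrite (le_trans (nfg x))// ler_norm.
- by apply/measurable_EFinP; exact: strongly_measurable_Im.
- move=> x _ /=; rewrite lee_fin (le_trans (ler_norm_Im _))//.
  by rewrite (le_trans (nfg x))// ler_norm.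
Qed.

Lemma sqnorm_mulconj (z : R[i]^o) : sqnorm z = complex.Re (z * conjC z).
Proof. by rewrite sqnormC; case: z => a b /=; ring. Qed.

Lemma ReD : {morph @complex.Re R : y z / y + z}.
Proof. by case=> [? ?] [? ?]. Qed.

(** Pythagoras' theorem.  The square |sum_i c_i g_i(x)|^2 is expanded into the
    real and imaginary parts of the c_i c_j^* and the g_i(x) g_j(x)^*; only
    the terms i = j survive integration. *)
Lemma sqnormL2_orthonormal (D : choiceType) (g : D -> X -> R[i]^o)
    (c : D -> R[i]) :
  (forall i, L2 mu (g i)) ->
  (forall i j, innerL2 mu (g i) (g j) = (i == j)%:R) ->
  finite_set [set i | c i != 0] ->
  sqnormL2 mu (\sum_(i \in [set: D]) c i *: g i)%R =
  (\sum_(i \in [set: D]) sqnorm (c i : R[i]^o))%:E.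
Proof.
move=> Lg og fc; have [r ur cr] := finite_support_seq fc.
rewrite (fsum_scale_seq g ur cr) (fsum_sqnorm_seq ur cr).
pose a i j := c i * conjC (c j); pose z i j x := g i x * conjC (g j x).
have zRI i j : has_integral (fun x => complex.Re (z i j x)) (i == j)%:R /\
    has_integral (fun x => complex.Im (z i j x)) 0.
  have [iR iI] := integrable_Re_Im_mulconj (Lg i) (Lg j).
  have := has_integral_Rintegral iI; have := has_integral_Rintegral iR.
  rewrite -[X in has_integral _ X]/(complex.Re (innerL2 mu (g i) (g j))).
  rewrite -[X in _ -> has_integral _ X -> _]/
    (complex.Im (innerL2 mu (g i) (g j))).
  by rewrite og /z; case: (i == j).
have Ez x : sqnorm ((\sum_(i <- r) c i *: g i) x) =
    \sum_(i <- r) \sum_(j <- r) (complex.Re (a i j) * complex.Re (z i j x) +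
      - complex.Im (a i j) * complex.Im (z i j x)).
  rewrite sqnorm_mulconj fct_sumE rmorph_sum mulr_suml.
  rewrite (big_morph (@complex.Re R) ReD erefl); apply: eq_bigr => i _.
  rewrite mulr_sumr (big_morph (@complex.Re R) ReD erefl).
  apply: eq_bigr => j _.
  rewrite rmorphM (_ : _ * _ = a i j * z i j x); last exact: mulrACA.
  by case: (a i j) (z i j x) => [? ?] [? ?] /=; rewrite mulNr.
have [_ <-] : has_integral (fun x => sqnorm ((\sum_(i <- r) c i *: g i) x))
    (\sum_(i <- r) sqnorm (c i : R[i]^o)).
  rewrite (funext Ez).
  rewrite (_ : \sum_(i <- r) _ = \sum_(i <- r) \sum_(j <- r)
    (complex.Re (a i j) * (i == j)%:R + - complex.Im (a i j) * 0)).
    apply: has_integral_sum => i; apply: has_integral_sum => j.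
    by have [? ?] := zRI i j; apply: has_integralD; apply: has_integralZ.
  rewrite [in LHS]big_seq [in RHS]big_seq; apply: eq_bigr => i ir.
  rewrite (bigD1_seq i)//= big1 ?addr0 => [|j /negPf ji].
    rewrite eqxx mulr1 mulr0 addr0 /a -normCK.
    by rewrite (@normE _ R[i]^o) -rmorphXn/=.
  by rewrite eq_sym ji !mulr0 addr0.
by [].
Qed.

End HasIntegral.

(** * From products to the pointwise Riesz property *)

Section ToPointwise.
Context d (X : measurableType d) (R : realType)
  (mu : {measure set X -> \bar R}).
Hypothesis mu_fin : (mu setT < +oo)%E.
Variables (V : normedModType R[i]) (J : countType) (phi : J -> X -> V).
Hypothesis phi_meas : forall j, strongly_measurable (phi j).
Variables (A B : R).
Hypotheses (A_gt0 : 0 < A) (A_le_B : A <= B).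

Let B_gt0 : 0 < B. Proof. exact: lt_le_trans A_le_B. Qed.

Let ind E : X -> R[i]^o := fun x => (\1_E x : R)%:C%C.

Let synth (c : J -> R[i]) (x : X) : V := \sum_(j \in [set: J]) c j *: phi j x.

Let energy (c : J -> R[i]) : R := \sum_(j \in [set: J]) sqnorm (c j : R[i]^o).

Lemma strongly_measurable_fsum (I : choiceType) (W : normedModType R[i])
    (f : I -> X -> W) (c : I -> R[i]) : (forall i, strongly_measurable (f i)) ->
  finite_set [set i | c i != 0] ->
  strongly_measurable (fun x => \sum_(i \in [set: I]) c i *: f i x).
Proof.
move=> mf /finite_support_seq[r ur cr].
rewrite (_ : (fun x => _) = fun x => \sum_(i <- r) c i *: f i x).
  apply: strongly_measurable_sum => i.
  exact: (strongly_measurableZ (@strongly_measurable_cst _ _ _ R[i]^o (c i))).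
by apply/funext => x; rewrite (fsum_scale_seq _ ur cr).
Qed.

Lemma fsum_scale_apply (I : choiceType) (W : lmodType R[i])
    (f : I -> X -> W) (c : I -> R[i]) x : finite_set [set i | c i != 0] ->
  (\sum_(i \in [set: I]) c i *: f i) x = \sum_(i \in [set: I]) c i *: f i x.
Proof.
move=> /finite_support_seq[r ur cr].
by rewrite !(fsum_scale_seq _ ur cr) fct_sumE.
Qed.

Lemma synth_measurable c : finite_set [set j | c j != 0] ->
  measurable_fun setT (fun x => sqnorm (synth c x)).
Proof.
move=> fc; apply: strongly_measurable_sqnorm.
exact: strongly_measurable_fsum.
Qed.

(** Two applications of [ae_le_of_setintegral_le], with a constant on one
    side. *)
Lemma ae_synth_bounds_of_setintegral c : finite_set [set j | c j != 0] ->
  (forall E, measurable E ->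
    ((A * energy c)%:E * mu E <= \int[mu]_(x in E) (sqnorm (synth c x))%:E)%E /\
    (\int[mu]_(x in E) (sqnorm (synth c x))%:E <=
      (B * energy c)%:E * mu E)%E) ->
  {ae mu, forall x, A * energy c <= sqnorm (synth c x)} /\
  {ae mu, forall x, sqnorm (synth c x) <= B * energy c}.
Proof.
move=> fc H; have e0 : 0 <= energy c by exact: fsum_sqnorm_ge0.
split; apply: ae_le_of_setintegral_le => //; try exact: synth_measurable.
- by move=> x; rewrite mulr_ge0// ltW.
- by move=> x; exact: sqnorm_ge0.
- by move=> E mE; rewrite integral_cst//; exact: (H E mE).1.
- by move=> x; exact: sqnorm_ge0.
- by move=> x; rewrite mulr_ge0// ltW.
- by move=> E mE; rewrite integral_cst//; exact: (H E mE).2.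
Qed.

Lemma L2_indic E : measurable E -> L2 mu (ind E).
Proof.
move=> mE; split; first exact: strongly_measurable_indic.
rewrite /sqnormL2 (eq_integral (fun x => (\1_E x)%:E)); last first.
  by move=> x _; rewrite sqnorm_indic.
rewrite integral_indic// setIT (le_lt_trans _ mu_fin)//.
by rewrite le_measure ?inE.
Qed.

(** For coefficients of the form a_i c_j the combination of the products
    factors pointwise as (sum_i a_i g_i) (sum_j c_j phi_j), which turns the
    Riesz inequalities of the products into inequalities between weighted
    integrals. *)
Lemma products_sum (I : choiceType) (g : I -> X -> R[i]^o) (a : I -> R[i])
    (c : J -> R[i]) : finite_set [set i | a i != 0] ->
  finite_set [set j | c j != 0] ->
  let b (p : I * J) := a p.1 * c p.2 in
  [/\ finite_set [set p | b p != 0],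
      \sum_(p \in [set: I * J]) sqnorm (b p : R[i]^o) =
        (\sum_(i \in [set: I]) sqnorm (a i : R[i]^o)) * energy c
    & sqnormL2 mu (\sum_(p \in [set: I * J]) b p *: products g phi p)%R =
      (\int[mu]_x (sqnorm (\sum_(i \in [set: I]) a i *: g i x) *
                   sqnorm (synth c x))%:E)%E].
Proof.
move=> fa fc b.
have fb : finite_set [set p | b p != 0].
  apply: sub_finite_set (finite_setX fa fc) => -[i j] /=.
  by rewrite /b mulf_eq0 negb_or => /andP[].
have [r ur ar] := finite_support_seq fa.
have [s us cs] := finite_support_seq fc.
have bE i j : b (i, j) = a i * c j by [].
split => //.
- rewrite (fsum_pair_seq ur us); last 2 first.
  + by move=> p pr; rewrite /b ar// mul0r sqnorm0.
  + by move=> p ps; rewrite /b cs// mulr0 sqnorm0.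
  rewrite /energy (fsum_sqnorm_seq ur ar) (fsum_sqnorm_seq us cs) mulr_suml.
  apply: eq_bigr => i _; rewrite mulr_sumr; apply: eq_bigr => j _.
  by rewrite -sqnormZ.
- apply: eq_integral => x _; congr EFin; rewrite fsum_scale_apply//.
  rewrite -sqnormZ; congr sqnorm.
  rewrite (fsum_pair_seq ur us); last 2 first.
  + by move=> p pr; rewrite /b ar// mul0r scale0r.
  + by move=> p ps; rewrite /b cs// mulr0 scale0r.
  rewrite /synth (fsum_scale_seq _ ur ar) (fsum_scale_seq _ us cs).
  rewrite scaler_suml; apply: eq_bigr => i _.
  rewrite scaler_sumr; apply: eq_bigr => j _.
  rewrite bE /products /= !scalerA; congr (_ *: _).
  exact: mulrAC.
Qed.

(** Finite combinations h of the basis are dense, and on them the Riesz bounds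
    of the products read A s |h|^2 <= int |h|^2 w <= B s |h|^2.  The upper
    bound is treated first: it makes w bounded, as the lower one requires. *)
Lemma ae_riesz_of_basis_products (D : choiceType) (g : D -> X -> R[i]^o) :
  orthonormal_basis mu g -> riesz_sequence_L2 mu (products g phi) A B ->
  {ae mu, forall x, riesz_sequence_in (phi ^~ x) A B}.
Proof.
move=> [Lg og dg] [_ _ rg]; apply: ae_riesz_sequence_in => // c fc /=.
rewrite -/(energy c); have e0 : 0 <= energy c by exact: fsum_sqnorm_ge0.
pose Q := [set h : X -> R[i]^o | exists2 a : D -> R[i],
  finite_set [set i | a i != 0] & h = \sum_(i \in [set: D]) a i *: g i].
have mQ h : Q h -> strongly_measurable h.
  move=> [a fa ->]; have := strongly_measurable_fsum (fun i => (Lg i).1) fa.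
  rewrite (_ : (fun x => _) = \sum_(i \in [set: D]) a i *: g i)//.
  by apply/funext => x; rewrite fsum_scale_apply.
have dQ E : measurable E -> forall e : R, 0 < e ->
    exists2 h, Q h & (sqnormL2 mu (ind E - h)%R < e%:E)%E.
  move=> mE e eg0; have [a fa ae] := dg _ (L2_indic mE) _ eg0.
  by exists (\sum_(i \in [set: D]) a i *: g i) => //; exists a.
have Qw h : Q h ->
    (\int[mu]_x (sqnorm (h x) * (A * energy c))%:E <=
     \int[mu]_x (sqnorm (h x) * sqnorm (synth c x))%:E)%E /\
    (\int[mu]_x (sqnorm (h x) * sqnorm (synth c x))%:E <=
     \int[mu]_x (sqnorm (h x) * (B * energy c))%:E)%E.
  move=> Qh; have mh := mQ _ Qh; case: Qh => a fa hE.
  have [fb bs bi] := products_sum g fa fc.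
  have /= := rg _ fb; rewrite bs bi.
  have hx x : h x = \sum_(i \in [set: D]) a i *: g i x.
    by rewrite hE fsum_scale_apply.
  under eq_integral do rewrite -hx.
  have hcst k : 0 <= k -> (\int[mu]_x (sqnorm (h x) * (k * energy c))%:E)%E =
      (k * ((\sum_(i \in [set: D]) sqnorm (a i : R[i]^o)) * energy c))%:E.
    move=> k0; rewrite [X in X%:E](_ : _ = (k * energy c) *
      \sum_(i \in [set: D]) sqnorm (a i : R[i]^o)); last first.
      by rewrite -mulrA; congr (_ * _); exact: mulrC.
    rewrite EFinM -(sqnormL2_orthonormal Lg og fa) -hE.
    rewrite /sqnormL2 -ge0_integralZl_EFin ?mulr_ge0//.
    - by apply: eq_integral => x _; rewrite mulrC EFinM.
    - by move=> x _; rewrite lee_fin sqnorm_ge0.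
    - by apply/measurable_EFinP; exact: strongly_measurable_sqnorm.
  by rewrite !hcst// ltW.
have mc k : measurable_fun setT (cst k : X -> R) by [].
have Bc : {ae mu, forall x, sqnorm (synth c x) <= B * energy c}.
  apply: (ae_le_of_dense_weights (w2 := cst (B * energy c)) mu_fin mQ dQ).
  - exact: synth_measurable.
  - exact: mc.
  - by move=> x; exact: sqnorm_ge0.
  - by move=> x; rewrite /= mulr_ge0// ltW.
  - by apply: aeW => x; exact: lexx.
  - by move=> h /Qw[].
split => //.
apply: (ae_le_of_dense_weights (w1 := cst (A * energy c)) mu_fin mQ dQ) => //.
- exact: synth_measurable.
- by move=> x; rewrite /= mulr_ge0// ltW.
- by move=> x; exact: sqnorm_ge0.
- exact: Bc.
- by move=> h /Qw[].
Qed.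

(** The hypothesis is used for one-element sequences only: the indicator of a
    set E of positive measure is a Riesz sequence with both bounds mu(E). *)
Lemma ae_riesz_of_riesz_products :
  (forall (I : countType) (g : I -> X -> R[i]^o) (a b : R),
    riesz_sequence_L2 mu g a b ->
    riesz_sequence_L2 mu (products g phi) (a * A) (b * B)) ->
  {ae mu, forall x, riesz_sequence_in (phi ^~ x) A B}.
Proof.
move=> H; apply: ae_riesz_sequence_in => // c fc; rewrite -/(energy c).
apply: ae_synth_bounds_of_setintegral => // E mE.
have mEfin : mu E \is a fin_num.
  by rewrite ge0_fin_numE// (le_lt_trans _ mu_fin)// le_measure ?inE.
have [mE0|mE0] := eqVneq (mu E) 0%E.
  rewrite mE0 !mule0 (null_set_integral mE _ mE0)//.
  exact/measurable_EFinP/(measurable_funS _ _ (synth_measurable fc)).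
pose m := fine (mu E).
have m0 : 0 < m by rewrite fine_gt0// lt0e mE0 measure_ge0 ltey_eq mEfin.
have unit_fsum (W : nmodType) (F : unit -> W) :
    \sum_(i \in [set: unit]) F i = F tt.
  by rewrite (@fsum_seq _ _ [:: tt])// ?big_seq1// => -[].
have finu (a : unit -> R[i]) : finite_set [set i | a i != 0].
  exact: finite_finset.
have indR (a : unit -> R[i]) : sqnormL2 mu (a tt *: ind E)%R =
    (m * sqnorm (a tt : R[i]^o))%:E.
  rewrite mulrC EFinM fineK// -[in RHS](setIT E).
  rewrite -(integral_indic mu measurableT mE).
  rewrite -ge0_integralZl_EFin ?sqnorm_ge0//.
  - apply: eq_integral => x _; rewrite -EFinM; congr EFin.
    by rewrite [LHS]sqnormZ sqnorm_indic.
  - by apply/measurable_EFinP.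
have [_ _ h] : riesz_sequence_L2 mu (products (fun _ : unit => ind E) phi)
    (m * A) (m * B).
  apply: H; split => [||a _ /=]; first by rewrite m0 lexx.
    by move=> _; exact: L2_indic.
  by rewrite !unit_fsum indR.
have [fb bs bi] := products_sum (fun _ : unit => ind E) (finu (fun=> 1)) fc.
have /= := h _ fb; rewrite bs bi !unit_fsum.
have -> : sqnorm (1 : R[i]^o) = 1 by rewrite sqnormC/= expr1n expr0n addr0.
rewrite mul1r setintegral_indic -{1 2}(fineK mEfin) -!EFinM.
under eq_integral do rewrite unit_fsum scale1r.
have eE D : m * D * energy c = D * energy c * fine (mu E).
  by rewrite -mulrA mulrC.
by rewrite !eE.
Qed.

End ToPointwise.

(** * Unconditional and extended sums *)

#[local] Existing Instance totally_filter.

Section UnconditionalSums.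
Import finmap.
Context (R : realType) (V : normedModType R[i]) (J : choiceType).

Lemma partial_sumE (t : J -> V) (A : {fset J}) :
  partial_sum t A = \sum_(j <- A) t j.
Proof. by rewrite /partial_sum (big_seq_fsetE _ A xpredT t). Qed.

(** The partial sums are constant on the finite sets that contain the
    support. *)
Lemma cvg_partial_sum_finite (t : J -> V) (r : seq J) : uniq r ->
  (forall j, j \notin r -> t j = 0) ->
  partial_sum t @ totally --> \sum_(j <- r) t j.
Proof.
move=> ur tr; apply: cvg_near_cst.
exists [fset j | j in r]%fset => // A /= /fsubsetP rA; rewrite partial_sumE.
rewrite -(fsum_seq ur tr) (@fsum_seq _ _ A t)// => j jA; apply: tr.
by apply: contraNN jA => jr; apply: rA; apply/imfsetP; exists j.
Qed.

Lemma sum_finite (t : J -> V) (r : seq J) : uniq r ->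
  (forall j, j \notin r -> t j = 0) -> summability.sum t = \sum_(j <- r) t j.
Proof.
move=> ur tr; apply: cvg_lim; first exact: norm_hausdorff.
exact: cvg_partial_sum_finite.
Qed.

End UnconditionalSums.

Section ExtendedSums.
Local Open Scope ereal_scope.
Context (R : realType).

Lemma esum_finite (J : choiceType) (a : J -> \bar R) (r : seq J) : uniq r ->
  (forall j, 0 <= a j) -> (forall j, j \notin r -> a j = 0) ->
  \esum_(j in [set: J]) a j = \sum_(j <- r) a j.
Proof.
move=> ur a0 ar.
have -> : \esum_(j in [set: J]) a j = \esum_(j in [set` r]) a j.
  rewrite [RHS]esum_mkcond; apply: eq_esum => j _.
  by rewrite mem_setE; case: ifPn => // /ar.
by rewrite esum_fset -?fsbig_seq//; exact: finite_seq.
Qed.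

(** The family [a] as a sequence, so that sums over J become series and commute
    with the integral. *)
Definition pickle_seq (J : countType) (a : J -> \bar R) (n : nat) : \bar R :=
  if @pickle_inv J n is Some j then a j else 0.

Lemma esum_nneseries (J : countType) (a : J -> \bar R) : (forall j, 0 <= a j) ->
  \esum_(j in [set: J]) a j = \sum_(n <oo) pickle_seq a n.
Proof.
move=> a0; have b0 n : 0 <= pickle_seq a n.
  by rewrite /pickle_seq; case: pickle_inv.
rewrite nneseries_esumT//.
have -> : \esum_(n in [set: nat]) pickle_seq a n =
    \esum_(n in @pickle J @` setT) pickle_seq a n.
  rewrite [RHS]esum_mkcond; apply: eq_esum => n _.
  case: ifPn => //; rewrite notin_setE => nJ.
  rewrite /pickle_seq; case E : (@pickle_inv J n) => [j|//].
  by exfalso; apply: nJ; exists j => //; have := @pickle_invK J n; rewrite E.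
rewrite esum_image; last by move=> i j _ _; exact: (pcan_inj pickleK).
by apply: eq_esum => j _; rewrite /pickle_seq pickleK_inv.
Qed.

Lemma measurable_esum d (X : measurableType d) (J : countType)
    (a : J -> X -> \bar R) : (forall j x, 0 <= a j x) ->
  (forall j, measurable_fun setT (a j)) ->
  measurable_fun setT (fun x => \esum_(j in [set: J]) a j x).
Proof.
move=> a0 ma; rewrite (_ : (fun x => _) =
    fun x => \sum_(n <oo) pickle_seq (a ^~ x) n).
  apply: ge0_emeasurable_sum => [n x _ _|n _]; rewrite /pickle_seq.
    by case: pickle_inv.
  by case: pickle_inv.
by apply/funext => x; exact: esum_nneseries.
Qed.

(** Tonelli's theorem for sums over a countable type, by way of
    [esum_nneseries]. *)
Lemma integral_esum d (X : measurableType d) (mu : {measure set X -> \bar R})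
    (J : countType) (a : J -> X -> \bar R) : (forall j x, 0 <= a j x) ->
  (forall j, measurable_fun setT (a j)) ->
  \int[mu]_x (\esum_(j in [set: J]) a j x) =
  \esum_(j in [set: J]) \int[mu]_x a j x.
Proof.
move=> a0 ma; under eq_integral do rewrite esum_nneseries//.
rewrite integral_nneseries//; last 2 first.
- by move=> n; rewrite /pickle_seq; case: pickle_inv.
- by move=> n x _; rewrite /pickle_seq; case: pickle_inv.
rewrite esum_nneseries; last by move=> j; exact: integral_ge0.
apply: eq_eseriesr => n _; rewrite /pickle_seq.
by case: pickle_inv => //; rewrite integral0.
Qed.

End ExtendedSums.

Section RieszSums.
Import finmap.
Context (R : realType) (V : completeNormedModType R[i]) (J : choiceType).
Variables (u : J -> V) (A B : R).
Hypothesis uAB : riesz_sequence_in u A B.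

(** The Riesz inequalities for coefficients restricted to a finite set, when
    the coefficients themselves need not be finitely supported. *)
Lemma riesz_bounds_seq (a : J -> R[i]) (r : seq J) : uniq r ->
  A * \sum_(j <- r) sqnorm (a j : R[i]^o) <=
    sqnorm (\sum_(j <- r) a j *: u j) /\
  sqnorm (\sum_(j <- r) a j *: u j) <= B * \sum_(j <- r) sqnorm (a j : R[i]^o).
Proof.
move=> ur; pose c j := if j \in r then a j else 0.
have cr j : j \notin r -> c j = 0 by rewrite /c => /negPf ->.
have fc : finite_set [set j | c j != 0].
  apply: sub_finite_set (finite_seq r) => j /=.
  by apply: contraNP => /negP /cr ->.
have [_ _ /(_ c fc)/=] := uAB.
rewrite (fsum_sqnorm_seq ur cr) (fsum_scale_seq _ ur cr) !lee_fin.
rewrite (eq_big_seq (fun j => sqnorm (a j : R[i]^o))); last first.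
  by move=> j jr; rewrite /c jr.
rewrite (eq_big_seq (fun j => a j *: u j))//.
by move=> j jr; rewrite /c jr.
Qed.

Let A_gt0 : 0 < A. Proof. by have [/andP[]] := uAB. Qed.
Let B_gt0 : 0 < B.
Proof. by have [/andP[h1 h2] _ _] := uAB; exact: lt_le_trans h2. Qed.

Variable a : J -> R[i].
Let E := (\esum_(j in [set: J]) (sqnorm (a j : R[i]^o))%:E)%E.
Hypothesis a_l2 : (E < +oo)%E.

Let partial_le_esum (r : seq J) : uniq r ->
  ((\sum_(j <- r) sqnorm (a j : R[i]^o))%:E <= E)%E.
Proof.
move=> ur; apply: esum_ge; exists [set` r]; first by split.
by rewrite -fsbig_seq// sumEFin.
Qed.

Let E_fin : E \is a fin_num.
Proof.
by rewrite ge0_fin_numE// esum_ge0// => j _; rewrite lee_fin sqnorm_ge0.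
Qed.

(** The upper Riesz bound makes the partial sums Cauchy: past a finite set
    that carries all but eta of sum_j |a_j|^2, two partial sums differ in
    squared norm by at most B eta. *)
Lemma cvg_riesz_sum : cvg (partial_sum (fun j => a j *: u j) @ totally).
Proof.
apply: cauchy_cvg; apply: cauchy_exP => e e0.
have [e' eE] : exists e', e = e'%:C%C.
  exists (complex.Re e); move: e0; rewrite ltcE/=.
  by case: e => x y /= /andP[/eqP -> _].
rewrite {}eE ltcR in e0 *.
(* Any eta with B eta < e'^2 will do. *)
pose eta := e' ^+ 2 / (2 * B).
have eta0 : 0 < eta by rewrite divr_gt0 ?exprn_gt0// mulr_gt0.
have [_ [F [fF _] <-] hF] := ub_ereal_sup_adherent eta0 E_fin.
rewrite fsbig_finite//= sumEFin in hF; rewrite -[X in (X + _ < _)%E]/E in hF.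
exists (partial_sum (fun j => a j *: u j) (fset_set F)).
exists (fset_set F) => // G /= FG.
rewrite -ball_normE /ball_ /= distrC normE ltcR.
rewrite !partial_sumE.
pose r := [seq j <- G | j \notin fset_set F].
have split_sum (W : zmodType) (h : J -> W) : \sum_(j <- G) h j =
    \sum_(j <- fset_set F) h j + \sum_(j <- r) h j.
  rewrite (bigID (mem (fset_set F)))/= /r big_filter; congr (_ + _).
  rewrite -big_filter; apply: perm_big; apply: uniq_perm.
  - exact/filter_uniq/fset_uniq.
  - exact: fset_uniq.
  - move=> j; rewrite mem_filter; apply/andb_idr => jF.
    exact: (fsubsetP FG).
have ur : uniq r by exact/filter_uniq/fset_uniq.
rewrite split_sum addrC addKr -ltr_sqr ?nnegrE ?rnorm_ge0 ?ltW// -sqnormE.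
have [_ h] := riesz_bounds_seq a ur.
apply: le_lt_trans h _.
have := partial_le_esum (fset_uniq G); rewrite split_sum.
rewrite -(fineK E_fin) -EFinD lte_fin in hF.
rewrite -(fineK E_fin) lee_fin => h.
rewrite mulrC -ltr_pdivlMr//.
apply: (@le_lt_trans _ _ eta); first by lra.
rewrite /eta ltr_pM2l ?exprn_gt0// ltf_pV2 ?posrE ?mulr_gt0//.
by rewrite ltr_pMl// ltr1n.
Qed.

(** The bounds pass to the limit along the finite subsets.  For the lower one,
    the inequality with a fixed finite sum on the left holds from that finite
    set on. *)
Lemma riesz_sum_bounds :
  (A%:E * E <= (sqnorm (summability.sum (fun j => a j *: u j)))%:E)%E /\
  ((sqnorm (summability.sum (fun j => a j *: u j)))%:E <= B%:E * E)%E.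
Proof.
have /(continuous_cvg _ (@sqnorm_continuous R V _)) := cvg_riesz_sum.
rewrite -/(summability.sum _) => ss; split.
- rewrite -lee_pdivlMl//; apply: ge_ereal_sup => _ [F [fF _] <-].
  rewrite fsbig_finite//= sumEFin -EFinM lee_fin ler_pdivlMl//.
  apply: (closed_cvg _ (@closed_ge R _) _ _ ss).
  exists (fset_set F) => // G /= FG; rewrite partial_sumE.
  have [h _] := riesz_bounds_seq a (fset_uniq G); apply: le_trans h.
  rewrite ler_pM2l// [leRHS](bigID (mem (fset_set F)))/= ler_wpDr//.
    by apply: sumr_ge0 => j _; exact: sqnorm_ge0.
  rewrite -[leRHS]big_filter le_eqVlt; apply/orP; left; apply/eqP.
  apply: perm_big; apply: uniq_perm.
  - exact: fset_uniq.
  - exact/filter_uniq/fset_uniq.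
  - move=> j; rewrite mem_filter; apply/esym/andb_idr => jF.
    exact: (fsubsetP FG).
- rewrite -(fineK E_fin) -EFinM lee_fin.
  apply: (closed_cvg _ (@closed_le R _) _ _ ss); apply: nearW => G /=.
  rewrite partial_sumE; have [_ h] := riesz_bounds_seq a (fset_uniq G).
  apply: le_trans h _; rewrite ler_pM2l// -lee_fin fineK//.
  exact: partial_le_esum.
Qed.

End RieszSums.

(** * Consequences of the pointwise Riesz property *)

Section FromPointwise.
Context d (X : measurableType d) (R : realType)
  (mu : {measure set X -> \bar R}).
Hypothesis mu_fin : (mu setT < +oo)%E.
Variables (V : completeNormedModType R[i]) (J : countType) (phi : J -> X -> V).
Hypothesis phi_meas : forall j, strongly_measurable (phi j).
Variables (A B : R).
Hypotheses (A_gt0 : 0 < A) (A_le_B : A <= B).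

Let A_ge0 : 0 <= A. Proof. exact: ltW. Qed.
Let B_ge0 : 0 <= B. Proof. exact: le_trans A_le_B. Qed.

(** Test functions f_j = c_j 1_E, with c finitely supported. *)
Lemma ae_riesz_of_finite_star :
  (forall f : J -> X -> R[i]^o, (forall j, L2 mu (f j)) ->
    finite_set [set j | ~ {ae mu, forall x, f j x = 0}] ->
    star mu phi A B f) ->
  {ae mu, forall x, riesz_sequence_in (phi ^~ x) A B}.
Proof.
move=> H; apply: ae_riesz_sequence_in => // c fc.
apply: ae_synth_bounds_of_setintegral => // E mE.
have [r ur cr] := finite_support_seq fc.
pose ind x : R[i]^o := (\1_E x : R)%:C%C.
pose f j x : R[i]^o := c j *: ind x.
have mind : strongly_measurable ind by exact: strongly_measurable_indic.
have sf j x : sqnorm (f j x) = sqnorm (c j : R[i]^o) * \1_E x.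
  by rewrite sqnormZ sqnorm_indic.
have Nf j : sqnormL2 mu (f j) = ((sqnorm (c j : R[i]^o))%:E * mu E)%E.
  rewrite /sqnormL2; under eq_integral do rewrite sf EFinM.
  rewrite ge0_integralZl_EFin ?sqnorm_ge0//.
  - by rewrite integral_indic// setIT.
  - by apply/measurable_EFinP.
have Lf j : L2 mu (f j).
  split.
    exact: (strongly_measurableZ (@strongly_measurable_cst _ _ _ R[i]^o _)).
  rewrite Nf lte_mul_pinfty// ?lee_fin ?sqnorm_ge0//.
  by rewrite (le_lt_trans _ mu_fin)// le_measure ?inE.
have f0 j x : j \notin r -> f j x = 0 by move=> /cr cj; rewrite /f cj scale0r.
have ff : finite_set [set j | ~ {ae mu, forall x, f j x = 0}].
  apply: sub_finite_set (finite_seq r) => j /=.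
  by apply: contra_notT => jr; apply: aeW => x; exact: f0.
have [_] := H f Lf ff.
rewrite (esum_finite ur); last 2 first.
- by move=> j; apply: integral_ge0 => x _; rewrite lee_fin sqnorm_ge0.
- by move=> j /cr cj; rewrite Nf cj sqnorm0 mul0e.
under [(\sum_(j <- r) _)%E]eq_bigr do rewrite Nf.
rewrite -ge0_sume_distrl; last by move=> j _; rewrite lee_fin sqnorm_ge0.
rewrite sumEFin -(fsum_sqnorm_seq ur cr) (setintegral_indic mu E).
rewrite !EFinM -!muleA.
have TE :
    (\int[mu]_x (sqnorm (summability.sum (fun j => f j x *: phi j x)))%:E)%E =
    (\int[mu]_x (sqnorm (ind x) *
      sqnorm (\sum_(j \in [set: J]) c j *: phi j x))%:E)%E;
  last by rewrite TE; split.
apply: eq_integral => x _; rewrite -sqnormZ; congr (sqnorm _)%:E.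
rewrite (sum_finite ur) => [|j /f0 ->]; last by rewrite scale0r.
rewrite (fsum_scale_seq _ ur cr) scaler_sumr; apply: eq_bigr => j _.
by rewrite /f !scalerA mulrC.
Qed.

Hypothesis phi_riesz : {ae mu, forall x, riesz_sequence_in (phi ^~ x) A B}.

(** Tonelli gives sum_j |f_j(x)|^2 < +oo for almost every x; there the
    pointwise bounds apply, and they are integrated. *)
Lemma star_of_ae_riesz (f : J -> X -> R[i]^o) : (forall j, L2 mu (f j)) ->
  (\esum_(j in [set: J]) sqnormL2 mu (f j) < +oo)%E -> star mu phi A B f.
Proof.
move=> Lf fE.
pose e x := (\esum_(j in [set: J]) (sqnorm (f j x))%:E)%E.
have mf j : measurable_fun setT (fun x => (sqnorm (f j x))%:E).
  by apply/measurable_EFinP; apply: strongly_measurable_sqnorm; case: (Lf j).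
have f0 j x : (0 <= (sqnorm (f j x))%:E)%E by rewrite lee_fin sqnorm_ge0.
have e0 x : (0 <= e x)%E by exact: esum_ge0.
have me : measurable_fun setT e by exact: measurable_esum.
have ie : (\int[mu]_x e x)%E = (\esum_(j in [set: J]) sqnormL2 mu (f j))%E.
  exact: integral_esum.
have efin : {ae mu, forall x, (e x < +oo)%E}.
  have /integrable_ae : mu.-integrable setT e.
    apply/integrableP; split => //.
    by under eq_integral do rewrite gee0_abs//; rewrite ie.
  move=> /(_ measurableT); apply: filterS => x /(_ I).
  by rewrite ge0_fin_numE.
have h : {ae mu, forall x, riesz_sequence_in (phi ^~ x) A B /\ (e x < +oo)%E}.
  by apply: filterS2 phi_riesz efin.
split.
- apply: filterS h => x [hx ex].
  exact: (@cvg_riesz_sum _ _ _ _ _ _ hx (f ^~ x) ex).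
- rewrite -ie -ge0_integralZl_EFin//.
  apply: ge0_ae_le_integral => [x|x|].
  + by rewrite mule_ge0// lee_fin.
  + by rewrite lee_fin sqnorm_ge0.
  + by apply: filterS h => x [hx ex]; case: (riesz_sum_bounds hx ex).
- rewrite -ie -ge0_integralZl_EFin//.
  apply: ge0_ae_le_integral => [x|x|].
  + by rewrite lee_fin sqnorm_ge0.
  + by rewrite mule_ge0// lee_fin.
  + by apply: filterS h => x [hx ex]; case: (riesz_sum_bounds hx ex).
Qed.

(** The combination with coefficients c(i, j) is sum_j f_j phi_j with
    f_j = sum_i c(i, j) g_i.  Integrating the pointwise bounds compares its
    squared norm with the sum of the squared norms of the f_j, which the Riesz
    bounds of g control one j at a time. *)
Lemma riesz_products_of_ae_riesz (I : choiceType) (g : I -> X -> R[i]^o)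
    (a b : R) : riesz_sequence_L2 mu g a b ->
  riesz_sequence_L2 mu (products g phi) (a * A) (b * B).
Proof.
move=> [/andP[a0 ab] Lg rg].
have phi_le_B j : {ae mu, forall x, sqnorm (phi j x) <= B}.
  apply: filterS phi_riesz => x hx.
  have [_] := riesz_bounds_seq hx (fun=> 1) (r := [:: j]) isT.
  by rewrite !big_seq1 scale1r sqnormC/= expr1n expr0n addr0 mulr1.
split.
- by rewrite mulr_gt0//= ler_pM// ltW.
- move=> [i j]; have [mg gfin] := Lg i; split.
    exact: strongly_measurableZ mg (phi_meas j).
  apply: (@le_lt_trans _ _ (B%:E * sqnormL2 mu (g i))%E).
    rewrite /sqnormL2 -ge0_integralZl_EFin//; last 2 first.
    + by move=> x _; rewrite lee_fin sqnorm_ge0.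
    + by apply/measurable_EFinP; exact: strongly_measurable_sqnorm.
    apply: ge0_ae_le_integral => [x|x|].
    + by rewrite lee_fin sqnorm_ge0.
    + by rewrite -EFinM lee_fin mulr_ge0 ?sqnorm_ge0.
    + apply: filterS (phi_le_B j) => x hx; rewrite -EFinM lee_fin sqnormZ mulrC.
      by rewrite ler_wpM2r// sqnorm_ge0.
  by rewrite lte_mul_pinfty// lee_fin.
move=> c fc /=; have [rs urs crs] := finite_support_seq fc.
pose r := undup (map fst rs); pose s := undup (map snd rs).
have ur : uniq r := undup_uniq _; have us : uniq s := undup_uniq _.
have cr p : p.1 \notin r -> c p = 0.
  by rewrite mem_undup => pr; apply: crs; apply: contraNN pr; exact: map_f.
have cs p : p.2 \notin s -> c p = 0.
  by rewrite mem_undup => ps; apply: crs; apply: contraNN ps; exact: map_f.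
pose f j := \sum_(i \in [set: I]) c (i, j) *: g i.
have cjr j i : i \notin r -> c (i, j) = 0 by move=> ir; exact: cr.
have fcj j : finite_set [set i | c (i, j) != 0].
  apply: sub_finite_set (finite_seq r) => i /=.
  by apply: contraNP => /negP /cjr ->.
have fx j x : f j x = \sum_(i <- r) c (i, j) *: g i x.
  by rewrite /f fsum_scale_apply// (fsum_scale_seq _ ur (cjr j)).
have mf j : measurable_fun setT (fun x => (sqnorm (f j x))%:E).
  apply/measurable_EFinP/strongly_measurable_sqnorm.
  rewrite (_ : f j = fun x => \sum_(i <- r) c (i, j) *: g i x).
    apply: strongly_measurable_sum => i; have [mg _] := Lg i.
    exact: (strongly_measurableZ (@strongly_measurable_cst _ _ _ R[i]^o _)).
  exact/funext/fx.
have f0 j x : (0 <= (sqnorm (f j x))%:E)%E by rewrite lee_fin sqnorm_ge0.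
pose S := \sum_(j <- s) \sum_(i <- r) sqnorm (c (i, j) : R[i]^o).
have SE : \sum_(p \in [set: I * J]) sqnorm (c p : R[i]^o) = S.
  rewrite (fsum_pair_seq ur us); first exact: exchange_big.
  - by move=> p /cr ->; rewrite sqnorm0.
  - by move=> p /cs ->; rewrite sqnorm0.
rewrite SE.
have intf : (\int[mu]_x (\sum_(j <- s) sqnorm (f j x))%:E)%E =
    (\sum_(j <- s) sqnormL2 mu (f j))%E.
  by under eq_integral do rewrite -sumEFin; rewrite ge0_integral_sum.
have vx x : (\sum_(p \in [set: I * J]) c p *: products g phi p) x =
    \sum_(j <- s) f j x *: phi j x.
  rewrite fsum_scale_apply// (fsum_pair_seq ur us); last 2 first.
  - by move=> p /cr ->; rewrite scale0r.
  - by move=> p /cs ->; rewrite scale0r.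
  rewrite exchange_big; apply: eq_bigr => j _; rewrite fx scaler_suml.
  by apply: eq_bigr => i _; rewrite /products /= scalerA.
have rgf j : ((a * \sum_(i <- r) sqnorm (c (i, j) : R[i]^o))%:E <=
      sqnormL2 mu (f j))%E /\
    (sqnormL2 mu (f j) <=
      (b * \sum_(i <- r) sqnorm (c (i, j) : R[i]^o))%:E)%E.
  have /= := rg _ (fcj j); rewrite (fsum_sqnorm_seq ur (cjr j)); exact.
have msum : measurable_fun setT (fun x => (\sum_(j <- s) sqnorm (f j x))%:E).
  under eq_fun do rewrite -sumEFin.
  exact: emeasurable_sum.
have sum0 x : (0 <= (\sum_(j <- s) sqnorm (f j x))%:E)%E.
  by rewrite lee_fin sumr_ge0// => j _; exact: sqnorm_ge0.
split.
- apply: (@le_trans _ _ (A%:E * \sum_(j <- s) sqnormL2 mu (f j))%E).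
    rewrite mulrAC mulrC EFinM lee_wpmul2l ?lee_fin//.
    rewrite /S mulr_sumr -sumEFin; apply: lee_sum => j _.
    exact: (rgf j).1.
  rewrite -intf -ge0_integralZl_EFin// /sqnormL2.
  apply: ge0_ae_le_integral => [x|x|].
  + by rewrite mule_ge0// lee_fin.
  + by rewrite lee_fin sqnorm_ge0.
  + apply: filterS phi_riesz => x hx; rewrite vx -EFinM lee_fin.
    exact: (riesz_bounds_seq hx (f ^~ x) us).1.
- apply: (@le_trans _ _ (B%:E * \sum_(j <- s) sqnormL2 mu (f j))%E).
    rewrite -intf -ge0_integralZl_EFin// /sqnormL2.
    apply: ge0_ae_le_integral => [x|x|].
    + by rewrite lee_fin sqnorm_ge0.
    + by rewrite mule_ge0// lee_fin.
    + apply: filterS phi_riesz => x hx; rewrite vx -EFinM lee_fin.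
      exact: (riesz_bounds_seq hx (f ^~ x) us).2.
  rewrite [leRHS](_ : _ = (B%:E * (b * S)%:E)%E); last first.
    by rewrite -EFinM mulrAC mulrC.
  rewrite lee_wpmul2l ?lee_fin//.
  rewrite /S mulr_sumr -sumEFin; apply: lee_sum => j _.
  exact: (rgf j).2.
Qed.

End FromPointwise.

(** * Maximal orthonormal sets in a complete inner product space *)

Section HilbertBasis.
Context (R : realType) (V : lmodType R) (K : set V) (ip : V -> V -> R).
Hypotheses (K0 : K 0) (KD : forall u v, K u -> K v -> K (u + v))
  (KZ : forall a u, K u -> K (a *: u)).
Hypotheses (ipC : forall u v, ip u v = ip v u)
  (ipD : forall u v w, K u -> K v -> K w -> ip (u + v) w = ip u w + ip v w)
  (ipZ : forall a u w, K u -> K w -> ip (a *: u) w = a * ip u w)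
  (ip_ge0 : forall u, 0 <= ip u u).

Let N u := ip u u.

(* Rapidly Cauchy sequences suffice: a minimizing sequence can be chosen to be
   one.  The rate makes the sum of the 2^n N (h n.+1 - h n) converge. *)
Hypothesis complete : forall h : nat -> V, (forall n, K (h n)) ->
  (forall n m, (n <= m)%N -> N (h m - h n) <= 8^-1 ^+ n) ->
  exists2 l, K l & forall n, N (l - h n) <= 8^-1 ^+ n.

Definition orthonormal_set (D : set V) : Prop :=
  D `<=` K /\ forall u v, D u -> D v -> ip u v = (u == v)%:R.

(** The inductive form makes closure properties immediate; coefficients are
    recovered in [linear_span_coeff]. *)
Inductive linear_span (D : set V) : V -> Prop :=
| linear_span0 : linear_span D 0
| linear_span_cons a u h :
    D u -> linear_span D h -> linear_span D (a *: u + h).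

Lemma linear_spanD D u v :
  linear_span D u -> linear_span D v -> linear_span D (u + v).
Proof.
elim=> [|a w h Dw _ IH]; rewrite ?add0r// => /IH hv.
by rewrite -addrA; exact: linear_span_cons.
Qed.

Lemma linear_spanZ D b u : linear_span D u -> linear_span D (b *: u).
Proof.
elim=> [|a w h Dw _ IH]; first by rewrite scaler0; exact: linear_span0.
by rewrite scalerDr scalerA; exact: linear_span_cons.
Qed.

Lemma linear_span_sub D : D `<=` K -> linear_span D `<=` K.
Proof.
by move=> DK u; elim=> [//|a w h /DK Kw _ Kh]; apply: KD => //; exact: KZ.
Qed.

Lemma linear_span1 (D : set V) u : D u -> linear_span D u.
Proof.
move=> Du; rewrite -[u]scale1r -[_ *: _]addr0.
exact: linear_span_cons (linear_span0 D).
Qed.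

Let KB u v : K u -> K v -> K (u - v).
Proof. by move=> Ku Kv; rewrite -scaleN1r; exact: KD (KZ _ _). Qed.

Lemma norm2_addZ a u v : K u -> K v ->
  N (u + a *: v) = N u + 2 * a * ip u v + a ^+ 2 * N v.
Proof.
move=> Ku Kv; have Kav := KZ a Kv; have Ks := KD Ku Kav.
rewrite /N ipD// ipZ// [ip u _]ipC [ip v _]ipC !ipD// !ipZ// [ip v u]ipC; ring.
Qed.

Let NB u v : K u -> K v -> N (u - v) = N u - 2 * ip u v + N v.
Proof. by move=> Ku Kv; rewrite -scaleN1r norm2_addZ//; ring. Qed.

Let NBC u v : K u -> K v -> N (u - v) = N (v - u).
Proof. by move=> Ku Kv; rewrite !NB// [ip v u]ipC; ring. Qed.

Let NDN u v : K u -> K v -> N (u + v) = N u + 2 * ip u v + N v.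
Proof. by move=> Ku Kv; rewrite -[v in LHS]scale1r norm2_addZ//; ring. Qed.

Let NZ a u : K u -> N (a *: u) = a ^+ 2 * N u.
Proof.
by move=> Ku; have Kau := KZ a Ku; rewrite /N ipZ// ipC ipZ// mulrA expr2.
Qed.

(** The Cauchy-Schwarz inequality for a unit vector v. *)
Lemma sqr_ip_le u v : K u -> K v -> N v = 1 -> ip u v ^+ 2 <= N u.
Proof.
move=> Ku Kv Nv; have := ip_ge0 (u + (- ip u v) *: v).
by rewrite -/(N _) norm2_addZ// Nv; nra.
Qed.

(** Used to let n tend to infinity in estimates that hold up to a multiple of
    8^-n. *)
Lemma ler0_geometric (x k : R) :
  (forall n : nat, x <= k * 8^-1 ^+ n) -> x <= 0.
Proof.
move=> xk; apply: (@ler_cvg_to _ \oo _ R (fun=> x) (fun n => k * 8^-1 ^+ n)).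
- exact: cvg_cst.
- rewrite -[X in _ --> X](mulr0 k); apply: cvgMl_tmp; apply: cvg_expr.
  by rewrite ger0_norm// invf_lt1// ltr1n.
- by apply: nearW => n; exact: xk.
Qed.

(** Zorn's lemma: orthonormality concerns two vectors at a time, so it passes
    to unions of chains. *)
Lemma maximal_orthonormal_set :
  exists2 D, orthonormal_set D & forall B, D `<` B -> ~ orthonormal_set B.
Proof.
have [|D [oD mD]] := @Zorn_bigcup V orthonormal_set; last by exists D.
move=> F oF tF; split; first by move=> u [D FD Du]; exact: (oF _ FD).1.
move=> u v [D FD Du] [E FE Ev].
by case: (tF _ _ FD FE) => DE; [apply: (oF _ FE).2|apply: (oF _ FD).2];
  rewrite //; exact: DE.
Qed.

(** If the span of D stays at positive distance from f, take a sequence in the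
    span that minimizes the distance to f.  By the parallelogram law it is
    Cauchy; let l be its limit.  Then f - l is nonzero, and by minimality it is
    orthogonal to D: normalized, it can be added to D. *)
Lemma maximal_orthonormal_total D : orthonormal_set D ->
  (forall B, D `<` B -> ~ orthonormal_set B) ->
  forall f, K f -> forall e, 0 < e ->
  exists2 h, linear_span D h & N (f - h) < e.
Proof.
move=> [DK oD] mD f Kf e e0; apply: contrapT => nh.
have he h : linear_span D h -> e <= N (f - h).
  by move=> Dh; rewrite leNgt; apply/negP => hh; apply: nh; exists h.
have spanK := linear_span_sub DK.
pose S := [set N (f - h) | h in linear_span D].
have hS : has_inf S.
  split; first by exists (N (f - 0)); exists 0 => //; exact: linear_span0.
  by exists e => _ [h Dh <-]; exact: he.
pose delta := inf S.
have hd h : linear_span D h -> delta <= N (f - h).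
  by move=> Dh; apply: ge_inf; [exact: hS.2|exists h].
have /choice[h hh] : forall n : nat, exists h, linear_span D h /\
    N (f - h) < delta + 8^-1 ^+ n / 4.
  move=> n; have [|_ [h Dh <-] hlt] := @inf_adherent _ S (8^-1 ^+ n / 4) _ hS.
    by rewrite divr_gt0// exprn_gt0.
  by exists h.
have Kh n : K (h n) by apply: spanK; exact: (hh n).1.
(* [r n] is the n-th residual; its squared norm is delta up to 8^-n / 4, a
   margin that the parallelogram law turns into 8^-n. *)
pose r n := f - h n.
have Kr n : K (r n) by exact: KB.
have cau n m : (n <= m)%N -> N (h m - h n) <= 8^-1 ^+ n.
  move=> nm; have -> : h m - h n = r n - r m.
    by rewrite /r opprB [RHS]addrC addrA subrK.
  have mid : delta <= N (2^-1 *: (r n + r m)).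
    have -> : 2^-1 *: (r n + r m) = f - 2^-1 *: (h n + h m).
      rewrite /r addrACA -opprD scalerBr; congr (_ - _).
      by rewrite scalerDr -scalerDl (_ : 2^-1 + 2^-1 = 1) ?scale1r//; lra.
    by apply: hd; apply/linear_spanZ/linear_spanD; exact: (hh _).1.
  rewrite (NZ _ (KD (Kr n) (Kr m))) (NDN (Kr n) (Kr m)) in mid.
  rewrite (NB (Kr n) (Kr m)).
  have := (hh n).2; have := (hh m).2; rewrite -/(r n) -/(r m).
  have : 8^-1 ^+ m <= 8^-1 ^+ n :> R by rewrite ler_wiXn2l// invf_le1// ler1n.
  move: mid; move: (8^-1 ^+ m) (8^-1 ^+ n) (N _) (N _) (ip _ _) => p q x y z.
  lra.
have [l Kl hl] := complete Kh cau.
pose g := f - l; have Kg : K g by exact: KB.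
have g_orth a : D a -> ip g a = 0.
  move=> Da; have Ka := DK _ Da; have Na : N a = 1 by rewrite /N oD// eqxx.
  apply/eqP; rewrite -sqrf_eq0 eq_le sqr_ge0 andbT.
  apply: (@ler0_geometric _ 4) => n.
  have -> : g = r n + (h n - l) by rewrite /g /r addrA subrK.
  have Khl : K (h n - l) by exact: KB.
  rewrite ipD//.
  have b1 := sqr_ip_le Khl Ka Na; rewrite NBC// in b1.
  have := le_trans b1 (hl n).
  (* Subtracting the component of r n along a would bring it below delta unless
     that component is small. *)
  have : delta <= N (r n + - ip (r n) a *: a).
    have -> : r n + - ip (r n) a *: a = f - (h n + ip (r n) a *: a).
      by rewrite /r scaleNr opprD addrA.
    apply/hd/linear_spanD; first exact: (hh n).1.
    exact/linear_spanZ/linear_span1.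
  rewrite norm2_addZ// Na; have := (hh n).2; rewrite -/(r n).
  move: (8^-1 ^+ n) (ip (r n) a) (ip _ a) => q x y.
  have := sqr_ge0 (x - y); nra.
have Ng : 0 < N g.
  rewrite lt0r ip_ge0 andbT; apply/eqP => Ng0.
  suff : e <= 0 by rewrite leNgt e0.
  apply: (@ler0_geometric _ 2) => n.
  have Klh : K (l - h n) by exact: KB.
  apply: (le_trans (he _ (hh n).1)).
  have -> : f - h n = g + (l - h n) by rewrite /g addrA subrK.
  have := ip_ge0 (g - (l - h n)); rewrite -/(N _) (NB Kg Klh) (NDN Kg Klh).
  by rewrite Ng0; have := hl n; move: (N _) (ip _ _) (8^-1 ^+ n) => x y q; lra.
pose s := (Num.sqrt (N g))^-1; pose g' := s *: g.
have sN : s ^+ 2 * N g = 1.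
  by rewrite exprVn sqr_sqrtr ?mulVf ?gt_eqF// ltW.
have Kg' : K g' by exact: KZ.
have Ng' : ip g' g' = 1 by rewrite ipZ// ipC ipZ// mulrA -expr2.
have g'_orth a : D a -> ip g' a = 0.
  by move=> Da; rewrite ipZ ?g_orth ?mulr0//; exact: DK.
have Dg' : ~ D g'.
  by move=> /g'_orth; rewrite Ng' => /eqP; rewrite oner_eq0.
apply: (mD (D `|` [set g'])).
  split; first by left.
  by move=> /(_ g') h1; apply: Dg'; apply: h1; right.
split; first by move=> u [/DK//|->].
move=> u v [Du|->] [Dv|->]; first exact: oD.
- rewrite ipC g'_orth//; case: eqP => // ug.
  by exfalso; apply: Dg'; rewrite -ug.
- rewrite g'_orth//; case: eqP => // ug.
  by exfalso; apply: Dg'; rewrite ug.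
- by rewrite eqxx Ng'.
Qed.

End HilbertBasis.

(** * Completeness of the real L^2 *)

Section RealSquareIntegrable.
Context d (X : measurableType d) (R : realType)
  (mu : {measure set X -> \bar R}).

Definition real_L2 : set (X -> R) :=
  [set f : X -> R | measurable_fun setT f /\
    (\int[mu]_x (f x ^+ 2)%R%:E < +oo)%E].

Definition real_ip (f g : X -> R) : R := \int[mu]_x (f x * g x).

Lemma real_L2_sqr_integrable f : real_L2 f ->
  mu.-integrable setT (EFin \o (fun x => f x ^+ 2)).
Proof.
move=> [mf fi]; apply/integrableP; split.
  by apply/measurable_EFinP; exact: measurable_funX.
under eq_integral do rewrite /= ger0_norm ?sqr_ge0//.
exact: fi.
Qed.

Lemma real_L2_mul_integrable f g : real_L2 f -> real_L2 g ->
  mu.-integrable setT (EFin \o (fun x => f x * g x)).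
Proof.
move=> Lf Lg; have [mf _] := Lf; have [mg _] := Lg.
have := integrableD measurableT (real_L2_sqr_integrable Lf)
  (real_L2_sqr_integrable Lg).
apply: le_integrable => //.
  by apply/measurable_EFinP; exact: measurable_funM.
move=> x _ /=; rewrite lee_fin [leRHS]ger0_norm ?addr_ge0 ?sqr_ge0// ler_norml.
have := sqr_ge0 (f x + g x); have := sqr_ge0 (f x - g x).
have := sqr_ge0 (f x); have := sqr_ge0 (g x).
move=> h1 h2 h3 h4; apply/andP; split; nra.
Qed.

Lemma real_ip_norm f : real_L2 f ->
  (real_ip f f)%:E = (\int[mu]_x (f x ^+ 2)%:E)%E.
Proof.
move=> Lf; rewrite /real_ip /Rintegral fineK//.
exact/integrable_fin_num/real_L2_sqr_integrable.
Qed.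

Lemma real_L20 : real_L2 0.
Proof.
split; first exact: measurable_cst.
by under eq_integral do rewrite expr0n; rewrite integral0.
Qed.

Lemma real_L2D f g : real_L2 f -> real_L2 g -> real_L2 (f + g).
Proof.
move=> Lf Lg; have [mf _] := Lf; have [mg _] := Lg.
split; first exact: measurable_funD.
have hD : mu.-integrable setT (EFin \o (fun x => (f + g) x ^+ 2)).
  have h1 := integrableD measurableT (real_L2_sqr_integrable Lf)
    (real_L2_sqr_integrable Lg).
  have := integrableZl measurableT 2 h1; apply: le_integrable => //.
    by apply/measurable_EFinP; apply: measurable_funX; exact: measurable_funD.
  move=> x _ /=; rewrite lee_fin.
  rewrite !ger0_norm ?sqr_ge0// ?mulr_ge0 ?addr_ge0 ?sqr_ge0//.
  have -> : (f + g) x = f x + g x by [].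
  have := sqr_ge0 (f x - g x); nra.
move/integrableP : hD => [_].
by under eq_integral do rewrite /= ger0_norm ?sqr_ge0//.
Qed.

Lemma real_L2Z a f : real_L2 f -> real_L2 (a *: f).
Proof.
move=> Lf; have [mf _] := Lf.
have h := integrableZl measurableT (a ^+ 2) (real_L2_sqr_integrable Lf).
split; first exact: measurable_funM.
move/integrableP : h => [_]; congr (_ < _)%E; apply: eq_integral => x _ /=.
congr EFin; rewrite ger0_norm; last by apply: mulr_ge0; exact: sqr_ge0.
exact/esym/exprMn.
Qed.

Lemma real_L2B f g : real_L2 f -> real_L2 g -> real_L2 (f - g).
Proof. by move=> Lf Lg; rewrite -scaleN1r; exact: real_L2D (real_L2Z _ _). Qed.

Lemma real_ipC f g : real_ip f g = real_ip g f.
Proof. by apply: eq_Rintegral => x _; rewrite mulrC. Qed.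

Lemma real_ipD f g k : real_L2 f -> real_L2 g -> real_L2 k ->
  real_ip (f + g) k = real_ip f k + real_ip g k.
Proof.
move=> Lf Lg Lk; rewrite /real_ip -RintegralD//; last 2 first.
- exact: real_L2_mul_integrable.
- exact: real_L2_mul_integrable.
by apply: eq_Rintegral => x _; rewrite mulrDl.
Qed.

Lemma real_ipZ a f k : real_L2 f -> real_L2 k ->
  real_ip (a *: f) k = a * real_ip f k.
Proof.
move=> Lf Lk; rewrite /real_ip -RintegralZl//.
- by apply: eq_Rintegral => x _; rewrite mulrA.
- exact: real_L2_mul_integrable.
Qed.

Lemma real_ip_ge0 f : 0 <= real_ip f f.
Proof. by apply: Rintegral_ge0 => x _; rewrite -expr2 sqr_ge0. Qed.

Hypothesis mu_fin : (mu setT < +oo)%E.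

(** |h_(n+1) - h_n| has a convergent series of integrals, hence a finite sum
    almost everywhere.  The integral of u = h_(n+1) - h_n is bounded without
    square roots, by |u| <= 2^n u^2 / 2 + 2^-(n+1), as mu is finite. *)
Lemma real_L2_rapid_cvg (h : nat -> X -> R) : (forall n, real_L2 (h n)) ->
  (forall n m, (n <= m)%N -> real_ip (h m - h n) (h m - h n) <= 8^-1 ^+ n) ->
  {ae mu, forall x, cvgn (fun n => h n x)}.
Proof.
move=> Lh hh; pose u n x := h n.+1 x - h n x.
have mh n : measurable_fun setT (h n) by case: (Lh n).
have m_u n : measurable_fun setT (u n) by exact: measurable_funB.
pose m := fine (mu setT).
have mE : m%:E = mu setT by rewrite fineK// ge0_fin_numE.
have m0 : 0 <= m by exact: fine_ge0.
have iu n : (\int[mu]_x `|u n x|%:E <= ((1 + m) / (2 ^ n.+1)%:R)%:E)%E.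
  apply: (@le_trans _ _ (\int[mu]_x ((2 ^+ n / 2)%:E * (u n x ^+ 2)%:E +
      (2^-1 ^+ n.+1)%:E))%E).
    apply: ge0_ae_le_integral => [x|x|].
    - by rewrite lee_fin.
    - by rewrite -EFinM -EFinD lee_fin addr_ge0// mulr_ge0// sqr_ge0.
    - apply: aeW => x; rewrite -EFinM -EFinD lee_fin.
      rewrite exprVn [2 ^+ n.+1]exprS invfM -[u n x ^+ 2]real_normK ?num_real//.
      have q0 : 0 < 2 ^+ n :> R by rewrite exprn_gt0.
      move: (2 ^+ n) q0 `|u n x| => q q0 y.
      rewrite -subr_ge0 (_ : _ - _ = (q * y - 1) ^+ 2 / (2 * q)).
        by rewrite divr_ge0// ?sqr_ge0// mulr_ge0// ltW.
      by field; rewrite gt_eqF.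
  have Lu : real_L2 (h n.+1 - h n) by exact: real_L2B.
  rewrite ge0_integralD//; last 2 first.
  - by move=> x _; rewrite -EFinM lee_fin mulr_ge0// sqr_ge0.
  - apply/measurable_EFinP; apply: measurable_funM => //.
    exact: measurable_funX.
  rewrite ge0_integralZl_EFin//; last 2 first.
  - by move=> x _; rewrite lee_fin sqr_ge0.
  - by apply/measurable_EFinP; exact: measurable_funX.
  rewrite integral_cst// -mE -(real_ip_norm Lu) -!EFinM -EFinD lee_fin.
  have := hh n n.+1 (leqnSn n); move: (real_ip _ _) => y hy.
  apply: (@le_trans _ _ (2 ^+ n / 2 * 8^-1 ^+ n + 2^-1 ^+ n.+1 * m)).
    by rewrite lerD2r ler_wpM2l.
  rewrite natrX mulrDl div1r; apply: lerD; last by rewrite exprVn mulrC.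
  rewrite exprVn [2 ^+ n.+1]exprS invfM (_ : 8 = 2 * 2 * 2 :> R); last by lra.
  rewrite !exprMn; have : 1 <= 2 ^+ n :> R by rewrite exprn_ege1// ler1n.
  move: (2 ^+ n) => q q1; have q0 : 0 < q by rewrite (lt_le_trans ltr01).
  rewrite (_ : q / 2 * _ = 2^-1 * (q * q)^-1); last by field; rewrite gt_eqF.
  by rewrite ler_wpM2l// lef_pV2 ?posrE ?mulr_gt0// ler_peMr// ltW.
pose F x := (\sum_(n <oo) `|u n x|%:E)%E.
have mu' n : measurable_fun setT (fun x => `|u n x|%:E).
  by apply/measurable_EFinP; exact: measurableT_comp.
have F0 x : (0 <= F x)%E by apply: nneseries_ge0 => n _ _; rewrite lee_fin.
have iF : (\int[mu]_x F x < +oo)%E.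
  rewrite integral_nneseries//.
  have m10 : 0 <= 1 + m by rewrite addr_ge0.
  apply: le_lt_trans (le_trans _ (epsilon_trick0 xpredT m10)) (ltry _).
  apply: lee_nneseries => // n _ _; exact: integral_ge0.
have /integrable_ae : mu.-integrable setT F.
  apply/integrableP; split; last by under eq_integral do rewrite gee0_abs//.
  exact: ge0_emeasurable_sum.
move=> /(_ measurableT); apply: filterS => x /(_ I).
rewrite ge0_fin_numE// => Fx.
have cu : cvgn (series (fun n => u n x)).
  apply: (@normed_cvg R R^o); apply: nnseries_is_cvg => // n.
  exact: normr_ge0.
have E : (fun n => h 0%N x + series (fun n => u n x) n) = (fun n => h n x).
  apply/funext => n; exact/esym/(eq_sum_telescope (fun n => h n x)).
have : cvgn (fun n => h 0%N x + series (fun n => u n x) n).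
  by apply: is_cvgD => //; exact: is_cvg_cst.
by rewrite E.
Qed.

(** The Riesz-Fischer theorem for a rapidly Cauchy sequence: the distance to
    the almost everywhere limit is bounded by Fatou's lemma. *)
Lemma real_L2_complete (h : nat -> X -> R) : (forall n, real_L2 (h n)) ->
  (forall n m, (n <= m)%N -> real_ip (h m - h n) (h m - h n) <= 8^-1 ^+ n) ->
  exists2 l, real_L2 l & forall n, real_ip (l - h n) (l - h n) <= 8^-1 ^+ n.
Proof.
move=> Lh hh; have ch := real_L2_rapid_cvg Lh hh.
have mh n : measurable_fun setT (h n) by case: (Lh n).
(* The upper limit is measurable everywhere, and equals the limit where there
   is one. *)
pose l x := fine (limn_esup (fun n => (h n x)%:E)).
have ml : measurable_fun setT l.
  apply: measurableT_comp => //; apply: measurable_fun_limn_esup => n.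
  exact/measurable_EFinP.
have hl : {ae mu, forall x, (fun n => h n x) @ \oo --> l x}.
  apply: filterS ch => x /cvg_ex[L hL].
  have hL' : (fun n => (h n x)%:E) @ \oo --> L%:E.
    by apply: cvg_EFin => //; exact: nearW.
  by rewrite /l (cvg_limn_einf_sup hL').2.
have il n : (\int[mu]_x ((l - h n) x ^+ 2)%:E <= (8^-1 ^+ n)%:E)%E.
  (* Shifting by n makes every term of the sequence satisfy the bound. *)
  pose g m x := ((h (m + n)%N x - h n x) ^+ 2)%:E.
  have mg m : measurable_fun setT (g m).
    by apply/measurable_EFinP; apply: measurable_funX; exact: measurable_funB.
  have g0 m x : (0 <= g m x)%E by rewrite lee_fin sqr_ge0.
  apply: (@le_trans _ _ (\int[mu]_x limn_einf (g ^~ x))%E).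
    apply: ge0_ae_le_integral => [x|x|].
    - by rewrite lee_fin sqr_ge0.
    - rewrite limn_einf_lim; apply: lime_ge; first exact: is_cvg_einfs.
      by apply: nearW => m; apply: le_ereal_inf_tmp => _ [k _ <-].
    - apply: filterS hl => x hx.
      have gx : (fun m => g m x) @ \oo --> ((l x - h n x) ^+ 2)%:E.
        apply: cvg_EFin; first by apply: nearW.
        have hx' : (fun m => h (m + n)%N x) @ \oo --> l x.
          by move: hx; rewrite -(cvg_shiftn n).
        have hd : (fun m => h (m + n)%N x - h n x) @ \oo --> l x - h n x.
          by apply: cvgB => //; exact: cvg_cst.
        exact: (cvgM hd hd).
      by rewrite (cvg_limn_einf_sup gx).1.
  apply: (le_trans (fatou _ _ _ _)) => //.
  rewrite limn_einf_lim; apply: lime_le; first exact: is_cvg_einfs.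
  apply: nearW => m; apply: (@le_trans _ _ (\int[mu]_x g m x)%E).
    by apply: ereal_inf_lbound; exists m => //=.
  have Lmn := real_L2B (Lh (m + n)%N) (Lh n).
  rewrite -[X in (X <= _)%E](real_ip_norm Lmn) lee_fin.
  by apply: hh; exact: leq_addl.
have Ll0 n : real_L2 (l - h n).
  split; first exact: measurable_funB.
  exact: le_lt_trans (il n) (ltry _).
exists l.
  have -> : l = (l - h 0%N) + h 0%N by rewrite subrK.
  exact: real_L2D.
by move=> n; rewrite -lee_fin (real_ip_norm (Ll0 n)).
Qed.

End RealSquareIntegrable.

(** * An orthonormal basis of L^2, and the equivalences *)

Section OrthonormalBasis.
Context d (X : measurableType d) (R : realType)
  (mu : {measure set X -> \bar R}).

Lemma linear_span_coeff (V : lmodType R) (D : set V) (h : V) :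
  linear_span D h -> exists2 c : set_type D -> R,
    finite_set [set i | c i != 0] &
    h = \sum_(i \in [set: set_type D]) c i *: val i.
Proof.
elim=> [|a u k Du _ [c fc ->]].
  exists (fun=> 0); last by rewrite fsbig1// => i _; rewrite scale0r.
  rewrite (_ : [set _ | _] = set0)//.
  by apply/seteqP; split=> i //=; rewrite eqxx.
pose iu : set_type D := SigSub (mem_set Du).
have [r ur cr] := finite_support_seq fc.
pose b i : R := if i == iu then a else 0.
pose s := undup (iu :: r).
have us : uniq s := undup_uniq _.
have cs i : i \notin s -> c i = 0.
  by rewrite mem_undup inE negb_or => /andP[_ /cr].
have bs i : i \notin s -> b i = 0.
  by rewrite mem_undup inE negb_or /b => /andP[/negPf ->].
exists (fun i => b i + c i).
  apply: sub_finite_set (finite_seq s) => i /=.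
  by apply: contraNP => /negP si; rewrite bs// cs// addr0.
rewrite (fsum_seq us); last by move=> i si; rewrite cs// scale0r.
rewrite (fsum_seq us); last by move=> i si; rewrite bs// cs// addr0 scale0r.
under [RHS]eq_bigr do rewrite scalerDl.
rewrite big_split/=; congr (_ + _).
rewrite (bigD1_seq iu)//=; last by rewrite mem_undup mem_head.
by rewrite big1 => [|i /negPf iiu]; rewrite /b ?eqxx ?addr0// iiu scale0r.
Qed.

Lemma sum_Complex (I : Type) (r : seq I) (a b : I -> R) :
  \sum_(i <- r) Complex (a i) (b i) =
  Complex (\sum_(i <- r) a i) (\sum_(i <- r) b i).
Proof.
by elim: r => [|i r IH]; rewrite ?big_nil// !big_cons IH.
Qed.

Lemma L2_Re_Im (f : X -> R[i]^o) : L2 mu f ->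
  real_L2 mu (fun x => complex.Re (f x)) /\
  real_L2 mu (fun x => complex.Im (f x)).
Proof.
move=> [mf fi].
split; split; [exact: strongly_measurable_Re| |exact: strongly_measurable_Im|];
  apply: le_lt_trans fi; apply: ge0_ae_le_integral => [x|x|];
  rewrite ?lee_fin ?sqr_ge0 ?sqnorm_ge0//; apply: aeW => x;
  by rewrite lee_fin sqnormC ?lerDl ?lerDr sqr_ge0.
Qed.

Hypothesis mu_fin : (mu setT < +oo)%E.

(** A maximal orthonormal set of real functions is an orthonormal basis of the
    complex space: real and imaginary parts are approximated separately. *)
Lemma orthonormal_basis_exists :
  exists (D : choiceType) (g : D -> X -> R[i]^o), orthonormal_basis mu g.
Proof.
have [D0 oD mD] :=
  @maximal_orthonormal_set R (X -> R^o) (real_L2 mu) (real_ip mu).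
have tD := maximal_orthonormal_total (@real_L20 _ _ _ mu) (@real_L2D _ _ _ mu)
  (@real_L2Z _ _ _ mu) (@real_ipC _ _ _ mu) (@real_ipD _ _ _ mu)
  (@real_ipZ _ _ _ mu) (@real_ip_ge0 _ _ _ mu)
  (@real_L2_complete _ _ _ mu mu_fin) oD mD.
exists (set_type D0), (fun i x => (val i x : R)%:C%C).
have LD i : real_L2 mu (\val (i : set_type D0)).
  by apply: oD.1; exact: set_valP.
split.
- move=> i; have [mi ii] := LD i; split; first exact: strongly_measurable_real.
  rewrite /sqnormL2; under eq_integral do rewrite sqnormC/= expr0n addr0.
  exact: ii.
- move=> i j; have := oD.2 (val i) (val j) (set_valP i) (set_valP j).
  rewrite (inj_eq val_inj) /real_ip /innerL2 => ij.
  apply/eqP; rewrite eq_complex; apply/andP; split; apply/eqP => /=.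
    rewrite [LHS](_ : _ = (i == j)%:R); first by case: (i == j).
    rewrite -ij; apply: eq_Rintegral => x _ /=; ring.
  rewrite [RHS](_ : _ = 0); last by case: (i == j).
  transitivity (\int[mu]_x (0 : R)); last by rewrite Rintegral_cst ?mul0r.
  by apply: eq_Rintegral => x _ /=; ring.
- move=> f Lf e e0; have [Lr Li] := L2_Re_Im Lf.
  have e2 : 0 < e / 2 by rewrite divr_gt0.
  have [h1 sh1 n1] := tD _ Lr _ e2; have [h2 sh2 n2] := tD _ Li _ e2.
  have Lh h : linear_span D0 h -> real_L2 mu h.
    exact: (linear_span_sub (@real_L20 _ _ _ mu) (@real_L2D _ _ _ mu)
      (@real_L2Z _ _ _ mu) oD.1).
  have L1 := Lh _ sh1; have L2' := Lh _ sh2.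
  have [c1 f1 E1] := linear_span_coeff sh1.
  have [c2 f2 E2] := linear_span_coeff sh2.
  have [r1 u1 z1] := finite_support_seq f1.
  have [r2 u2 z2] := finite_support_seq f2.
  pose r := undup (r1 ++ r2); have ur : uniq r := undup_uniq _.
  have c1r i : i \notin r -> c1 i = 0.
    by rewrite mem_undup mem_cat negb_or => /andP[/z1].
  have c2r i : i \notin r -> c2 i = 0.
    by rewrite mem_undup mem_cat negb_or => /andP[_ /z2].
  pose c i : R[i] := Complex (c1 i) (c2 i).
  have cr i : i \notin r -> c i = 0 by move=> ir; rewrite /c c1r// c2r.
  exists c.
    apply: sub_finite_set (finite_seq r) => i /=.
    by apply: contraNP => /negP /cr ->.
  rewrite (fsum_scale_seq _ ur cr).
  rewrite (fsum_seq ur) in E1; last by move=> i /c1r ->; rewrite scale0r.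
  rewrite (fsum_seq ur) in E2; last by move=> i /c2r ->; rewrite scale0r.
  have sE x : (\sum_(i <- r) c i *: (fun x => (val i x)%:C%C : R[i]^o)) x =
      Complex (h1 x) (h2 x).
    rewrite fct_sumE E1 E2 !fct_sumE -sum_Complex; apply: eq_bigr => i _.
    rewrite [LHS](_ : _ = Complex (c1 i) (c2 i) * (val i x)%:C%C)//.
    rewrite [RHS](_ : _ = Complex (c1 i * val i x) (c2 i * val i x))//.
    by apply/eqP; rewrite eq_complex/=; apply/andP; split; apply/eqP; ring.
  set fr := (fun x => complex.Re (f x)) in Lr n1 *.
  set fi := (fun x => complex.Im (f x)) in Li n2 *.
  have -> : sqnormL2 mu
      (f - \sum_(i <- r) c i *: (fun x => (val i x)%:C%C : R[i]^o))%R =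
      (\int[mu]_x (((fr - h1) x ^+ 2)%:E + ((fi - h2) x ^+ 2)%:E))%E.
    apply: eq_integral => x _; rewrite -EFinD; congr EFin.
    rewrite sqnormC [(f - _) x](_ : _ = f x - Complex (h1 x) (h2 x)).
      rewrite [(fr - h1) x](_ : _ = complex.Re (f x) - h1 x)//.
      rewrite [(fi - h2) x](_ : _ = complex.Im (f x) - h2 x)//.
      by case: (f x).
    by rewrite -sE.
  have m1 : real_L2 mu (fr - h1) by exact: real_L2B.
  have m2 : real_L2 mu (fi - h2) by exact: real_L2B.
  rewrite ge0_integralD//; last 4 first.
  + by move=> x _; rewrite lee_fin sqr_ge0.
  + by apply/measurable_EFinP; apply: measurable_funX; case: m1.
  + by move=> x _; rewrite lee_fin sqr_ge0.
  + by apply/measurable_EFinP; apply: measurable_funX; case: m2.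
  rewrite -(real_ip_norm m1) -(real_ip_norm m2) -EFinD lte_fin.
  by rewrite [e]splitr ltrD.
Qed.

Lemma orthonormal_basis_riesz (D : choiceType) (g : D -> X -> R[i]^o) :
  orthonormal_basis mu g -> riesz_sequence_L2 mu g 1 1.
Proof.
move=> [Lg og _]; split => //; first by rewrite ltr01 lexx.
by move=> c fc /=; rewrite (sqnormL2_orthonormal Lg og fc) mul1r.
Qed.

End OrthonormalBasis.

Theorem theorem2p3 (R : realType) (d : measure_display) (X : measurableType d)
    (mu : {measure set X -> \bar R}) (mu_fin : (mu [set: X] < +oo)%E)
    (H : completeNormedModType R[i]) (dot : {dot H for (@conjC R[i])})
    (dot_norm : forall v : H, dot v v = `|v| ^+ 2)
    (J : countType) (phi : J -> X -> H) (phi_L2 : forall j, L2 mu (phi j))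
    (A B : R) (A_gt0 : 0 < A) (A_le_B : A <= B) :
  [<->
    exists (D : choiceType) (g : D -> X -> R[i]^o),
      orthonormal_basis mu g /\ riesz_sequence_L2 mu (products g phi) A B;

    forall (I : countType) (g : I -> X -> R[i]^o) (a b : R),
      riesz_sequence_L2 mu g a b ->
      riesz_sequence_L2 mu (products g phi) (a * A) (b * B);

    forall f : J -> X -> R[i]^o,
      (forall j, L2 mu (f j)) ->
      finite_set [set j | ~ {ae mu, forall x, f j x = 0}] ->
      star mu phi A B f;

    forall f : J -> X -> R[i]^o,
      (forall j, L2 mu (f j)) ->
      (\esum_(j in [set: J]) sqnormL2 mu (f j) < +oo)%E ->
      star mu phi A B f;

    {ae mu, forall x, riesz_sequence_in (phi ^~ x) A B}].
Proof.
have phi_meas j : strongly_measurable (phi j) by case: (phi_L2 j).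
have ii_v :=
  @ae_riesz_of_riesz_products _ _ _ _ mu_fin _ _ _ phi_meas _ _ A_gt0 A_le_B.
have v_iv pr := @star_of_ae_riesz _ _ _ mu _ _ phi _ _ A_gt0 A_le_B pr.
have iv_iii : (forall f : J -> X -> R[i]^o, (forall j, L2 mu (f j)) ->
      (\esum_(j in [set: J]) sqnormL2 mu (f j) < +oo)%E -> star mu phi A B f) ->
    forall f : J -> X -> R[i]^o, (forall j, L2 mu (f j)) ->
      finite_set [set j | ~ {ae mu, forall x, f j x = 0}] -> star mu phi A B f.
  (* Members of the family that vanish almost everywhere contribute 0, so the
     sum of the squared norms is a finite sum of finite terms. *)
  move=> h f Lf /finite_seqP[r rE]; apply: h => //.
  rewrite (@esum_finite _ _ _ (undup r)) ?undup_uniq//; last 2 first.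
  - by move=> j; apply: integral_ge0 => x _; rewrite lee_fin sqnorm_ge0.
  - move=> j; rewrite mem_undup => jr.
    have fj0 : {ae mu, forall x, f j x = 0}.
      apply: contrapT => nj; move/negP: jr; apply.
      by have : [set` r] j by rewrite -rE.
    apply/eqP; rewrite eq_le; apply/andP; split; last first.
      by apply: integral_ge0 => x _; rewrite lee_fin sqnorm_ge0.
    rewrite -(integral0 mu setT); apply: ge0_ae_le_integral => [x|x|].
    + by rewrite lee_fin sqnorm_ge0.
    + by [].
    + by apply: filterS fj0 => x ->; rewrite sqnorm0.
  by apply/lte_sum_pinfty => j _; case: (Lf j).
have iii_v :=
  @ae_riesz_of_finite_star _ _ _ _ mu_fin _ _ _ phi_meas _ _ A_gt0 A_le_B.
have v_ii (pr : {ae mu, forall x, riesz_sequence_in (phi ^~ x) A B})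
    (I : choiceType) :=
  @riesz_products_of_ae_riesz _ _ _ mu _ _ phi phi_meas _ _ A_gt0 A_le_B pr I.
tfae.
- move=> [D [g [og rg]]] I.
  apply: v_ii.
  exact: (ae_riesz_of_basis_products mu_fin phi_meas A_gt0 A_le_B og rg).
- by move=> /ii_v /v_iv.
- by move=> /iii_v /v_iv.
- by move=> /iv_iii /iii_v.
- move=> v; have [D [g og]] := orthonormal_basis_exists mu_fin.
  exists D, g; split => //.
  rewrite -[A]mul1r -[B]mul1r; apply: v_ii => //.
  exact: orthonormal_basis_riesz.
Qed.
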